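(* Let $\mu_0,\mu_1,\mu_2\in\mathbb{R}$ with $\mu_\star^2:=\mu_2-\mu_0^2-\mu_1^2\ge 0$, and let $Z\sim\mathcal N(0,1)$. Consider the problem $$\min_\sigma\ \|\sigma\|_1:=\mathbb E\big(|\sigma'(Z)|\big)\quad\text{subject to}\quad \mathbb E(\sigma(Z))=\mu_0,\ \ \mathbb E(Z\sigma(Z))=\mu_1,\ \ \mathbb E(\sigma(Z)^2)=\mu_2,$$ over all weakly differentiable functions $\sigma:\mathbb R\to\mathbb R$ such that $\mathbb E(\sigma(Z)^2)$ and $\mathbb E(|\sigma'(Z)|)$ are defined and finite. Then one minimizer of this problem is $$\sigma(x)=\mu_0+b\,\min\{\max\{x,-s\},s\},\qquad b=\frac{\mu_1}{\operatorname{erf}(s/\sqrt2)},$$ where, if $\mu_\star\neq0$, $s\in\mathbb R$ is the unique solution of the equation $$\frac{\mu_1^2}{\mu_\star^2}=g(s),\qquad g(s)=\frac{e^{s^2/2}\,\operatorname{erf}(s/\sqrt2)^2}{e^{s^2/2}\big(1-\operatorname{erf}(s/\sqrt2)\big)\big(s^2+\operatorname{erf}(s/\sqrt2)\big)-\sqrt{2/\pi}\,s},$$ and $s=+\infty$ if $\mu_\star=0$.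
   Context: $\operatorname{erf}(t)=\frac{2}{\sqrt\pi}\int_0^t e^{-u^2}\,du$ is the Gauss error function, with $\operatorname{erf}(+\infty)=1$. Derivatives are understood in the weak sense, and functions agreeing outside a set of measure zero (with respect to the Gaussian measure) are identified. When $s=+\infty$, $\min\{\max\{x,-s\},s\}=x$.
   Formalization: If μ⋆≠0, the claim fails for μ1²/μ⋆² ≤ 2/(π−2): s is negative (σ constant, infeasible) or does not exist (μ1=0 or equality). Formally: s exists and is unique if μ1≠0 and μ1²/μ⋆²≠2/(π−2); σ is a minimizer when s>0, i.e. μ1²/μ⋆²>2/(π−2). *)

(* Defs.v *)
From HB Require Import structures.
From mathcomp Require Import all_boot all_order all_algebra.
From mathcomp Require Import all_classical all_reals all_analysis.

Set Implicit Arguments.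
Unset Strict Implicit.
Unset Printing Implicit Defensive.

Import Order.TTheory GRing.Theory Num.Theory.
Import numFieldNormedType.Exports.

Local Open Scope classical_set_scope.
Local Open Scope ring_scope.

(* [gauss_fun u] is exp(-u^2).  The integral from 0 to t is oriented, so that
   erf is defined, and odd, on the whole real line. *)
Definition erf {R : realType} (t : R) : R :=
  2 / Num.sqrt pi *
  (if 0 <= t then \int[@lebesgue_measure R]_(u in `[0, t]) gauss_fun u
   else - \int[@lebesgue_measure R]_(u in `[t, 0]) gauss_fun u).

Definition erfe {R : realType} (t : \bar R) : R :=
  match t with
  | r%:E => erf r
  | +oo%E => 1
  | -oo%E => -1
  end.

Definition test_function {R : realType} (phi : R -> R) : Prop :=
  (forall (n : nat) (x : R), derivable (derive1n n phi) x 1) /\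
  compact (closure [set x | phi x != 0]).

Definition weak_derivative {R : realType} (sigma dsigma : R -> R) : Prop :=
  [/\ locally_integrable setT sigma,
      locally_integrable setT dsigma &
      forall phi : R -> R, test_function phi ->
        \int[@lebesgue_measure R]_x (sigma x * derive1 phi x) =
        - \int[@lebesgue_measure R]_x (dsigma x * phi x)].

Definition law_std_normal {d : measure_display} {T : measurableType d}
    {R : realType} (P : probability T R) (Z : {RV P >-> R}) : Prop :=
  forall A : set (measurableTypeR R), measurable A ->
    distribution P Z A = normal_prob 0 1 A.

(* [dsigma] is carried along explicitly; weak derivatives are unique up to null
   sets, so nothing below depends on which representative is taken. *)
Definition feasible {d : measure_display} {T : measurableType d}
    {R : realType} (P : probability T R) (Z : {RV P >-> R})
    (mu0 mu1 mu2 : R) (sigma dsigma : R -> R) : Prop :=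
  [/\ weak_derivative sigma dsigma,
      P.-integrable setT (fun w => (sigma (Z w) ^+ 2)%:E),
      P.-integrable setT (fun w => `|dsigma (Z w)|%:E) &
      [/\ ('E_P[fun w => sigma (Z w)] = mu0%:E)%E,
          ('E_P[fun w => (Z w * sigma (Z w))%R] = mu1%:E)%E &
          ('E_P[fun w => (sigma (Z w) ^+ 2)%R] = mu2%:E)%E]].

Definition is_minimizer {d : measure_display} {T : measurableType d}
    {R : realType} (P : probability T R) (Z : {RV P >-> R})
    (mu0 mu1 mu2 : R) (sigma : R -> R) : Prop :=
  exists2 dsigma : R -> R,
    feasible Z mu0 mu1 mu2 sigma dsigma &
    forall tau dtau : R -> R, feasible Z mu0 mu1 mu2 tau dtau ->
      ('E_P[fun w => `|dsigma (Z w)|%R] <= 'E_P[fun w => `|dtau (Z w)|%R])%E.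

Definition mustar2 {R : realType} (mu0 mu1 mu2 : R) : R :=
  mu2 - mu0 ^+ 2 - mu1 ^+ 2.

Definition clip_activation {R : realType} (mu0 mu1 : R) (s : \bar R) (x : R) : R :=
  mu0 + mu1 / erfe (s * ((Num.sqrt 2)^-1)%:E)%E
        * fine (Order.min (Order.max x%:E (- s)%E) s).

(* The formula is a genuine quotient only for s != 0: numerator and denominator
   both vanish at s = 0, where g has the removable singularity 2 / (pi - 2). *)
Definition g {R : realType} (s : R) : R :=
  let E := erf (s / Num.sqrt 2) in
  let e := expR (s ^+ 2 / 2) in
  e * E ^+ 2 / (e * (1 - E) * (s ^+ 2 + E) - Num.sqrt (2 / pi) * s).

(* Main.v *)
Require Import Defs.
From HB Require Import structures.
From mathcomp Require Import all_boot all_order all_algebra.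
From mathcomp Require Import all_classical all_reals all_analysis.
From mathcomp Require Import measurable_realfun ring lra.

(* Stein's identity E[Z tau(Z)] = E[tau'(Z)] turns the constraint on E[Z tau(Z)]
   into E[tau'(Z)] = mu1, so every feasible tau has E|tau'(Z)| >= |mu1|, and a
   monotone feasible function attains this bound.  Clipped linear functions are
   monotone; the first two constraints fix their offset and slope, and the
   third one becomes mu1^2 / mustar^2 = g(s).

   With E(s) = erf(s / sqrt 2) and q = E', the reciprocal of g is
   N / E^2 where N(s) = (1 - E)(s^2 + E) - s q, and
   (N / E^2)' = 2 (E - s q) (s (1 - E) - q) / E^3.  Here E - s q and E^3 have the
   sign of s, and s (1 - E) < q is the Mills ratio bound, so 1/g decreases
   strictly on each half-line, from +oo at -oo through its limit (pi - 2) / 2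
   at 0 down to 0 at +oo. *)

Set Implicit Arguments.
Unset Strict Implicit.
Unset Printing Implicit Defensive.

Import Order.TTheory GRing.Theory Num.Theory.
Import numFieldNormedType.Exports.

Local Open Scope classical_set_scope.
Local Open Scope ring_scope.

(** * Expectations under the standard normal law as weighted Lebesgue integrals *)

Section standard_normal_law.
Context {R : realType}.
Local Notation mu := (@lebesgue_measure R).
Local Notation nu := (@normal_prob R 0 1).
Local Notation p := (@normal_pdf R 0 1).

(** A weak derivative may be tested only against smooth functions of compact support, and the
    Gaussian density is not one. Stein's identity is therefore reached by multiplying the density
    with a bump built from exp(-1/x) and letting its width grow. The bump needs no plateau: its
    value at 0 is a common factor of both limits and cancels. The function g arises as follows. Let
    v(s) be the second moment of Z clipped to [-s, s]. Clipping has the indicator of [-s, s] as weak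
    derivative, so its correlation with Z is E(s). This forces the slope mu1 / E(s), and the third
    constraint reads mu1^2 v / E^2 = mu1^2 + mustar^2. Hence mustar^2 / mu1^2 = v / E^2 - 1, and v -
    E^2 is exactly N. Both N and E^2 vanish at 0, so the limit there comes from L'Hopital's rule.
    That limit is a value of 1/g at no s, and it separates the equations with a positive solution
    from those with a negative one. *)

Lemma ge0_integral_std_normal (f : R -> \bar R) :
  measurable_fun setT f -> (forall x, (0 <= f x)%E) ->
  (\int[nu]_x f x = \int[mu]_x (f x * (p x)%:E))%E.
Proof.
move=> mf f0.
have dom : nu `<< mu := normal_prob_dominates 0 1.
rewrite -(Radon_Nikodym_SigmaFinite.change_of_variables dom)//.
apply: ae_eq_integral => //.
- apply: emeasurable_funM => //.
  exact: measurable_int (Radon_Nikodym_SigmaFinite.f_integrable dom).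
- apply: emeasurable_funM => //; apply/measurable_EFinP.
  exact: measurable_normal_pdf.
(* The Radon-Nikodym derivative agrees with [p] almost everywhere, since both integrate to [nu A]
   over every measurable [A]. *)
- apply: ae_eqe_mul2l; apply: integral_ae_eq => //.
  + exact: Radon_Nikodym_SigmaFinite.f_integrable.
  + apply/measurable_EFinP; exact: measurable_normal_pdf.
  + by move=> A _ mA; rewrite -Radon_Nikodym_SigmaFinite.f_integral.
Qed.

Context {d : measure_display} {T : measurableType d} {P : probability T R}
  {Z : {RV P >-> R}} (hZ : law_std_normal Z).

Lemma ge0_expectation_std_normal (f : R -> \bar R) :
  measurable_fun setT f -> (forall x, (0 <= f x)%E) ->
  (\int[P]_w f (Z w) = \int[mu]_x (f x * (p x)%:E))%E.
Proof.
move=> mf f0; rewrite -ge0_integral_std_normal//.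
have mZ : measurable_fun setT (Z : T -> measurableTypeR R) 
  by move=> mD A mA; exact: (@measurable_funPT _ _ _ _ Z mD A mA).
have := @ge0_integral_pushforward _ _ T (measurableTypeR R) R Z mZ P setT f.
rewrite preimage_setT => <- //.
by apply: eq_measure_integral => A mA _; exact: hZ.
Qed.

Lemma integrable_std_normal (f : R -> R) : measurable_fun setT f ->
  P.-integrable setT (fun w => (f (Z w))%:E) <->
  mu.-integrable setT (fun x => (f x * p x)%:E).
Proof.
move=> mf.
have mfp : measurable_fun setT (fun x => (f x * p x)%:E).
  apply/measurable_EFinP; apply: measurable_funM => //.
  exact: measurable_normal_pdf.
have mfZ : measurable_fun setT (fun w => (f (Z w))%:E).
  by apply/measurable_EFinP; exact: (measurableT_comp mf).
have E : (\int[P]_w `|(f (Z w))%:E| = \int[mu]_x `|(f x * p x)%:E|)%E.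
  rewrite (@ge0_expectation_std_normal (fun x => `|(f x)%:E|%E))//; last first.
    by apply: measurableT_comp => //; exact/measurable_EFinP.
  apply: eq_integral => x _.
  by rewrite EFinM abseM (@gee0_abs _ (p x)%:E)// lee_fin normal_pdf_ge0.
by split=> /integrableP[_ h]; apply/integrableP; split => //;
  [rewrite -E | rewrite E].
Qed.

Lemma expectation_std_normal (f : R -> R) : measurable_fun setT f ->
  mu.-integrable setT (fun x => (f x * p x)%:E) ->
  'E_P[fun w => f (Z w)]%E = (\int[mu]_x (f x * p x))%:E.
Proof.
move=> mf ifp; rewrite unlock integralE.
have mE : measurable_fun setT (EFin \o f) by exact/measurable_EFinP.
have pE : (fun w => (f (Z w))%:E)^\+%E = (fun w => (EFin \o f)^\+%E (Z w)).
  by apply/funext => w; rewrite !funeposE.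
have nE : (fun w => (f (Z w))%:E)^\-%E = (fun w => (EFin \o f)^\-%E (Z w)).
  by apply/funext => w; rewrite !funenegE.
rewrite pE nE.
rewrite (@ge0_expectation_std_normal (EFin \o f)^\+%E)//; last exact: measurable_funepos.
rewrite (@ge0_expectation_std_normal (EFin \o f)^\-%E)//; last exact: measurable_funeneg.
rewrite /Rintegral fineK; last exact: integrable_fin_num.
rewrite [in RHS]integralE; congr (_ - _)%E; apply: eq_integral => x _.
  (* As [p] is nonnegative, multiplication by it commutes with positive and negative parts. *)
  by rewrite !funeposE/= maxe_pMl ?lee_fin ?normal_pdf_ge0// mul0e -EFinM.
by rewrite !funenegE/= maxe_pMl ?lee_fin ?normal_pdf_ge0// mul0e -EFinM mulNr.
Qed.

End standard_normal_law.

(** * Differentiation rules for real functions *)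

Section pointwise_derivatives.
Context {R : realType}.
Implicit Types (f g df dg : R -> R) (x : R).

(** The arithmetic rules are restated for pointwise expressions, with products in place of scalar
    multiplication, so that [ring] and [field] can close the derivative values. *)
Lemma is_derive1D f g x a b : is_derive x 1 f a -> is_derive x 1 g b ->
  is_derive x 1 (fun y => f y + g y) (a + b).
Proof. by move=> ? ?; exact: is_deriveD. Qed.

Lemma is_derive1B f g x a b : is_derive x 1 f a -> is_derive x 1 g b ->
  is_derive x 1 (fun y => f y - g y) (a - b).
Proof. by move=> ? ?; exact: is_deriveB. Qed.

Lemma is_derive1M f g x a b : is_derive x 1 f a -> is_derive x 1 g b ->
  is_derive x 1 (fun y => f y * g y) (a * g x + f x * b).
Proof.
move=> hf hg; apply: is_derive_eq (is_deriveM hf hg) _.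
by rewrite /GRing.scale/=; ring.
Qed.

Lemma is_derive1Ml f x c a : is_derive x 1 f a ->
  is_derive x 1 (fun y => c * f y) (c * a).
Proof. by move=> ?; exact: (is_deriveZ c). Qed.

Lemma is_derive1V f x a : f x != 0 -> is_derive x 1 f a ->
  is_derive x 1 (fun y => (f y)^-1) (- a / f x ^+ 2).
Proof.
move=> f0 hf; apply: is_derive_eq (is_deriveV f0 hf) _.
by rewrite /GRing.scale/=; field.
Qed.

Lemma is_derive1_affine x a b : is_derive x 1 (fun y : R => a * y + b) a.
Proof.
apply: is_derive_eq (is_derive1D (is_derive1Ml a (is_derive_id x 1))
  (is_derive_cst b x 1)) _.
by rewrite mulr1 addr0.
Qed.

Lemma is_derive1_continuous f df : (forall x, is_derive x 1 f (df x)) ->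
  continuous f.
Proof.
move=> fdf x; apply: differentiable_continuous.
by apply/derivable1_diffP; case: (fdf x).
Qed.

Lemma derive1_funE f df : (forall x, is_derive x 1 f (df x)) -> derive1 f = df.
Proof. by move=> fdf; apply/funext => x; rewrite derive1E; case: (fdf x). Qed.

Lemma derivable_is_derive1 f x : derivable f x 1 -> is_derive x 1 f (derive1 f x).
Proof. by move=> df; rewrite derive1E; exact: derivableP. Qed.

(** The difference quotient is at most [C] times the modulus of [h]. This handles the origin, where
    the two branches of [flat] meet. *)
Lemma is_derive1_quadratic_bound f (C x : R) :
  (forall h, `|f (x + h) - f x| <= C * h ^+ 2) -> is_derive x 1 f 0.
Proof.
move=> fC.
have C0 : 0 <= C.
  by have := fC 1; rewrite expr1n mulr1; apply: le_trans.
have cv : (fun h => h^-1 *: ((f \o shift x) (h *: 1) - f x)) @ 0^' --> (0 : R).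
  apply/cvgrPdist_le => e e0; near=> h.
  have h0 : h != 0 by near: h; exact: nbhs_dnbhs_neq.
  have -> : (f \o shift x) (h *: 1) - f x = f (x + h) - f x.
    by rewrite /= [_ *: _]mulr1 (addrC h).
  rewrite sub0r normrN normrM normfV.
  rewrite ler_pdivrMl ?normr_gt0// (le_trans (fC h))//.
  rewrite -real_normK ?num_real// expr2 mulrA [leRHS]mulrC ler_wpM2r//.
  (* Dividing by [C + 1] rather than [C] also covers [C = 0]. *)
  have hd : `|h| <= e / (C + 1).
    near: h; apply: dnbhs0_le.
    by rewrite divr_gt0// ltr_wpDl.
  have : C * `|h| <= C * (e / (C + 1)) by rewrite ler_wpM2l.
  move/le_trans; apply.
  by rewrite mulrCA ler_piMr ?(ltW e0)// ler_pdivrMr ?ltr_wpDl// mul1r lerDl.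
by apply: DeriveDef; [apply/cvg_ex; exists 0 | exact: cvg_lim].
Unshelve. all: by end_near. Qed.

End pointwise_derivatives.

(** * Functions with derivatives of every order *)

Section smooth.
Context {R : realType}.
Implicit Types (f g df dg : R -> R) (x : R).

(* [n.+1] derivatives exist everywhere: the count is off by one. *)
Fixpoint nderivable n f : Prop :=
  (forall x, derivable f x 1) /\
  (if n is m.+1 then nderivable m (derive1 f) else True).

Lemma nderivable_derivable n f x : nderivable n f -> derivable f x 1.
Proof. by case: n => [|n] [+ _]; exact. Qed.

Lemma nderivableW n f : nderivable n.+1 f -> nderivable n f.
Proof. by elim: n f => [|n IH] f [df]; [move=> _ | move=> /IH]. Qed.

Lemma nderivableS n f df : (forall x, is_derive x 1 f (df x)) ->
  nderivable n df -> nderivable n.+1 f.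
Proof.
move=> fdf ndf; split; first by move=> x; case: (fdf x).
by rewrite (derive1_funE fdf).
Qed.

Lemma nderivable0 f df : (forall x, is_derive x 1 f (df x)) -> nderivable 0 f.
Proof. by move=> fdf; split => // x; by case: (fdf x). Qed.

Lemma nderivableD n f g : nderivable n f -> nderivable n g ->
  nderivable n (fun x => f x + g x).
Proof.
elim: n f g => [|n IH] f g [df nf] [dg ng].
  apply: nderivable0 => x.
  by apply: is_derive1D; apply: derivable_is_derive1.
apply: nderivableS (IH _ _ nf ng) => x.
by apply: is_derive1D; apply: derivable_is_derive1.
Qed.

Lemma nderivableM n f g : nderivable n f -> nderivable n g ->
  nderivable n (fun x => f x * g x).
Proof.
elim: n f g => [|n IH] f g hf hg.
  apply: nderivable0 => x.
  by apply: is_derive1M; apply: derivable_is_derive1;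
    [apply: nderivable_derivable hf|apply: nderivable_derivable hg].
have [[df nf] [dg ng]] := (hf, hg).
apply: (@nderivableS _ _ (fun x => derive1 f x * g x + f x * derive1 g x)).
  by move=> x; apply: is_derive1M; apply: derivable_is_derive1.
by apply: nderivableD; apply: IH => //; exact: nderivableW.
Qed.

Lemma nderivable_cst n (c : R) : nderivable n (cst c).
Proof.
elim: n c => [|n IH] c; first exact: (@nderivable0 _ (cst 0)).
exact: (@nderivableS _ _ (cst 0)).
Qed.

Lemma nderivable_affine n (a b : R) : nderivable n (fun x => a * x + b).
Proof.
case: n => [|n]; first by apply: nderivable0 => x; exact: is_derive1_affine.
apply: (@nderivableS _ _ (cst a)); last exact: nderivable_cst.
by move=> x; exact: is_derive1_affine.
Qed.

Lemma is_derive1_comp_affine f x (a b df : R) : is_derive (a * x + b) 1 f df ->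
  is_derive x 1 (fun y => f (a * y + b)) (a * df).
Proof.
move=> hf; rewrite mulrC.
exact: (is_derive1_comp (g := fun y => a * y + b) hf (is_derive1_affine x a b)).
Qed.

Lemma nderivable_comp_affine n f (a b : R) : nderivable n f ->
  nderivable n (fun x => f (a * x + b)).
Proof.
elim: n f => [|n IH] f [df nf].
  apply: nderivable0 => x.
  by apply: is_derive1_comp_affine; apply: derivable_is_derive1.
apply: (@nderivableS _ _ (fun x => a * derive1 f (a * x + b))).
  by move=> x; apply: is_derive1_comp_affine; apply: derivable_is_derive1.
by apply: nderivableM; [exact: nderivable_cst | exact: IH].
Qed.

(** [nderivable] differentiates once and recurses on the derivative, which suits induction through
    the product rule, while [test_function] speaks of [derive1n]. This lemma and the next pass
    between the two. *)
Lemma nderivable_derive1n f : (forall n, nderivable n f) ->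
  forall n x, derivable (derive1n n f) x 1.
Proof.
move=> hf n x; have := hf n; elim: n f {hf} => [|n IH] f [df nf]; first exact: df.
by rewrite derive1Sn; exact: IH.
Qed.

Lemma derive1n_nderivable f : (forall n x, derivable (derive1n n f) x 1) ->
  forall n, nderivable n f.
Proof.
move=> hf n; elim: n f hf => [|n IH] f hf; split=> //; try exact: (hf 0%N).
by apply: IH => m x; rewrite -derive1Sn.
Qed.

End smooth.

(** * Smooth functions vanishing on a half-line *)

Section bump.
Context {R : realType}.
Implicit Types (P : {poly R}) (x y : R).

Lemma poly_expR_bounded P :
  exists2 C : R, 0 <= C & forall y, 0 <= y -> `|P.[y]| * expR (- y) <= C.
Proof.
(* A single term of the exponential series bounds the k-th power of y by k factorial times
   exp(y). *)
have pow k y : 0 <= y -> y ^+ k * expR (- y) <= k`!%:R.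
  move=> y0; rewrite expRN ler_pdivrMr ?expR_gt0//.
  case: k => [|k]; first by rewrite expr0 fact0 mul1r -expR0 ler_expR.
  have := expR_ge1Dxn k y0; have f0 : 0 < k.+1`!%:R :> R by rewrite ltr0n fact_gt0.
  move=> h; rewrite mulrC -ler_pdivrMr//; apply: le_trans h; lra.
(* The weight [y ^+ k] makes the induction on coefficients go through: the factor 'X in P * 'X + c
   raises the exponent in the hypothesis on P by one. *)
suff /(_ 0%N)[C C0 H] : forall k, exists2 C : R, 0 <= C &
    forall y, 0 <= y -> y ^+ k * `|P.[y]| * expR (- y) <= C.
  by exists C => // y y0; have := H y y0; rewrite expr0 mul1r.
elim/poly_ind: P => [|P c IH] k.
  by exists 0 => // y _; rewrite horner0 normr0 mulr0 mul0r.
have [C C0 HC] := IH k.+1.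
exists (C + `|c| * k`!%:R); first by rewrite addr_ge0 ?mulr_ge0.
move=> y y0; rewrite hornerMXaddC.
have yk : 0 <= y ^+ k by rewrite exprn_ge0.
have e0 : 0 <= expR (- y) by rewrite expR_ge0.
have h1 : `|P.[y] * y + c| <= `|P.[y]| * y + `|c|.
  by rewrite (le_trans (ler_normD _ _))// normrM (ger0_norm y0).
apply: (@le_trans _ _ (y ^+ k * (`|P.[y]| * y + `|c|) * expR (- y))).
  by rewrite ler_wpM2r// ler_wpM2l.
have -> : y ^+ k * (`|P.[y]| * y + `|c|) * expR (- y) =
    y ^+ k.+1 * `|P.[y]| * expR (- y) + `|c| * (y ^+ k * expR (- y)).
  by rewrite exprS; ring.
by rewrite lerD ?HC// ler_wpM2l// pow.
Qed.

(* The class of functions [flat P] is stable under differentiation, also at 0. *)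
Definition flat P x : R := if 0 < x then P.[x^-1] * expR (- x^-1) else 0.

Lemma flat_bounded P : exists2 C : R, 0 <= C & forall x, `|flat P x| <= C.
Proof.
have [C C0 HC] := poly_expR_bounded P; exists C => // x; rewrite /flat.
case: ifPn => [x0|_]; last by rewrite normr0.
by rewrite normrM (ger0_norm (expR_ge0 _)) HC// invr_ge0 ltW.
Qed.

(** For x > 0 the chain rule gives (P - P')(1/x) exp(-1/x) / x^2, whence the polynomial X^2 (P -
    P'). For x < 0 the function is locally zero, and at 0 a quadratic bound gives derivative 0. *)
Lemma is_derive_flat P x :
  is_derive x 1 (flat P) (flat ('X^2 * (P^`() *- 1 + P)) x).
Proof.
have [x0|x0|<-] := ltgtP 0 x.
- pose f y : R := P.[y^-1] * expR (- y^-1).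
  have hf : is_derive x 1 f (flat ('X^2 * (P^`() *- 1 + P)) x).
    have xn0 : x != 0 by rewrite gt_eqF.
    have hV : is_derive x 1 (fun y : R => y^-1) (- 1 / x ^+ 2).
      exact: (@is_derive1V _ id).
    have hN : is_derive x 1 (fun y : R => - y^-1) (1 / x ^+ 2).
      by apply: is_derive_eq (is_deriveN hV) _; field.
    have h1 := is_derive1_comp (is_derive_poly P x^-1) hV.
    have h2 := @is_derive1_comp _ _ (fun y : R => - y^-1) _ _ _
      (is_derive_expR (- x^-1)) hN.
    apply: is_derive_eq (is_derive1M h1 h2) _.
    rewrite /flat x0 !hornerE mulr1n /=; field.
    exact: xn0.
  apply: near_eq_is_derive hf; near=> y.
  have y0 : 0 < y by near: y; exact: lt_nbhsr.
  by rewrite /flat y0.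
- have -> : flat ('X^2 * (P^`() *- 1 + P)) x = 0 by rewrite /flat lt_gtF.
  apply: near_eq_is_derive (is_derive_cst (0 : R) x 1).
  near=> y; have y0 : y < 0 by near: y; exact: lt_nbhsl.
  by rewrite /flat lt_gtF.
- rewrite {2}/flat ltxx.
  (* The additional factor ['X^2] turns boundedness into a bound of [flat P h] by [C * h ^+ 2]. *)
  have [C C0 HC] := poly_expR_bounded ('X^2 * P).
  apply: (@is_derive1_quadratic_bound _ _ C) => h.
  rewrite add0r {2}/flat ltxx subr0 /flat; case: ifPn => [h0|_]; last first.
    by rewrite normr0 mulr_ge0// sqr_ge0.
  have hV0 : 0 <= h^-1 by rewrite invr_ge0 ltW.
  have H : (h ^+ 2)^-1 * (`|P.[h^-1]| * expR (- h^-1)) <= C.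
    by have := HC _ hV0; rewrite hornerM hornerXn normrM ger0_norm ?exprn_ge0// exprVn mulrA.
  by rewrite normrM (ger0_norm (expR_ge0 _)) -ler_pdivrMr ?exprn_gt0// mulrC.
Unshelve. all: by end_near. Qed.

Lemma nderivable_flat n P : nderivable n (flat P).
Proof.
elim: n P => [|n IH] P; first by apply: nderivable0 => x; exact: is_derive_flat.
by apply: nderivableS (IH _) => x; exact: is_derive_flat.
Qed.

End bump.

(** * Smoothness and second moment of the Gaussian density *)

Section gaussian_density.
Context {R : realType}.
Local Notation mu := (@lebesgue_measure R).
Local Notation p := (@normal_pdf R 0 1).

Lemma normal_pdf01E : p = (fun x => normal_peak 1 * expR (- (x ^+ 2 / 2))).
Proof.
apply/funext => x; rewrite normal_pdfE ?oner_neq0// /normal_fun.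
by rewrite subr0 expr1n mulNr.
Qed.

Lemma is_derive_normal_pdf01 (x : R) : is_derive x 1 p (- x * p x).
Proof.
rewrite normal_pdf01E.
have h : is_derive x 1 (fun y : R => - (y ^+ 2 / 2)) (- x).
  have := is_deriveN (is_derive1Ml (2^-1) (is_deriveX 2 (is_derive_id x 1))).
  move/is_derive_eq => H; rewrite (_ : (fun y : R => _) =
    (fun y : R => - (2^-1 * y ^+ 2))); last by apply/funext => y; rewrite mulrC.
  by apply: H; rewrite /GRing.scale/=; field.
have := is_derive1Ml (normal_peak 1) (is_derive1_comp (is_derive_expR _) h).
by move/is_derive_eq; apply => /=; ring.
Qed.

Lemma nderivable_normal_pdf01 n : nderivable n p.
Proof.
elim: n => [|n IH].
  by apply: nderivable0 => x; exact: is_derive_normal_pdf01.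
apply: (@nderivableS _ _ _ (fun x => (-1 * x + 0) * p x)).
  by move=> x; rewrite mulN1r addr0; exact: is_derive_normal_pdf01.
by apply: nderivableM => //; exact: nderivable_affine.
Qed.

Lemma measurable_normal_pdf01 : measurable_fun setT p.
Proof. exact: measurable_normal_pdf. Qed.

(** Half of the exponent absorbs the square: x^2 exp(-x^2/4) is at most 4, and the remaining
    exp(-x^2/4) is, up to normalization, the density of variance 2. *)
Lemma integrable_sqr_normal_pdf01 :
  mu.-integrable setT (fun x => (x ^+ 2 * p x)%:E).
Proof.
have s2 : Num.sqrt 2 != 0 :> R by rewrite gt_eqF// sqrtr_gt0.
(* The 4 is the bound just described; the quotient of peaks exchanges the two normalizing
   constants. *)
pose c : R := 4 * normal_peak 1 / normal_peak (Num.sqrt 2).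
have : mu.-integrable setT (fun x => (c * normal_pdf 0 (Num.sqrt 2) x)%:E).
  exact: (integrableZl measurableT c (integrable_normal_pdf 0 (Num.sqrt 2))).
apply: le_integrable => //.
  by apply/measurable_EFinP; apply: measurable_funM => //; exact: measurable_normal_pdf01.
move=> x _; rewrite !abse_EFin lee_fin.
rewrite ger0_norm; last by exact: mulr_ge0 (sqr_ge0 x) (normal_pdf_ge0 0 1 x).
apply: le_trans (ler_norm _).
rewrite normal_pdf01E normal_pdfE// /normal_fun subr0 sqr_sqrtr//.
rewrite (_ : 2 *+ 2 = 4 :> R); last by rewrite -mulr_natr; ring.
have -> : c * (normal_peak (Num.sqrt 2) * expR (- x ^+ 2 / 4)) =
  normal_peak 1 * (4 * expR (- x ^+ 2 / 4)).
  by rewrite /c; field; rewrite gt_eqF// normal_peak_gt0.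
rewrite mulrCA ler_wpM2l ?normal_peak_ge0//.
have -> : - (x ^+ 2 / 2) = - x ^+ 2 / 4 - x ^+ 2 / 4 by field.
rewrite expRD mulrCA [leRHS]mulrC ler_wpM2l ?expR_ge0//.
rewrite expRN ler_pdivrMr ?expR_gt0//.
have := expR_ge1Dx (x ^+ 2 / 4); lra.
Qed.

Lemma normal_pdf01_gt0 x : 0 < p x.
Proof. by rewrite normal_pdf01E mulr_gt0 ?expR_gt0// normal_peak_gt0. Qed.

End gaussian_density.

(** * Domination and dominated convergence for real-valued integrals *)

Section integrals.
Context {R : realType}.
Local Notation mu := (@lebesgue_measure R).

Lemma le_integrable_EFin (f g : R -> R) : measurable_fun setT f ->
  (forall x, `|f x| <= g x) -> mu.-integrable setT (EFin \o g) ->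
  mu.-integrable setT (EFin \o f).
Proof.
move=> mf fg; apply: le_integrable => //; first exact/measurable_EFinP.
by move=> x _; rewrite /= lee_fin (le_trans (fg x))// ler_norm.
Qed.

Lemma Rintegral_dominated_cvg (f_ : nat -> R -> R) (f g : R -> R) :
  (forall n, measurable_fun setT (f_ n)) -> measurable_fun setT f ->
  (forall x, f_ n x @[n --> \oo] --> f x) ->
  mu.-integrable setT (EFin \o g) -> (forall n x, `|f_ n x| <= g x) ->
  \int[mu]_x f_ n x @[n --> \oo] --> \int[mu]_x f x.
Proof.
move=> mf_ mf ff ig fg.
have mfE n : measurable_fun setT (EFin \o f_ n) by exact/measurable_EFinP.
have mE : measurable_fun setT (EFin \o f) by exact/measurable_EFinP.
have cvE : {ae mu, forall x, setT x -> (EFin \o f_ n) x @[n --> \oo] --> (EFin \o f) x}.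
  by apply: aeW => x _; apply: cvg_EFin; [exact: nearW | exact: ff].
have leE : {ae mu, forall x n, setT x -> (`|(EFin \o f_ n) x| <= (EFin \o g) x)%E}.
  by apply: aeW => x n _; rewrite /= lee_fin.
have [if0 _ cv] := @dominated_convergence _ _ R mu setT measurableT
  (fun n => EFin \o f_ n) (EFin \o f) (EFin \o g) mfE mE cvE ig leE.
apply: fine_cvg; rewrite fineK; first exact: cv.
exact: integrable_fin_num.
Qed.


End integrals.

(** * Stein's identity for weak derivatives *)

Section stein.
Context {R : realType}.
Local Notation mu := (@lebesgue_measure R).
Local Notation p := (@normal_pdf R 0 1).

(** On the open interval from -1 to 1 this is exp(-1/(1+x) - 1/(1-x)), and it is 0 elsewhere. The
    coefficients [1] and [-1] are spelled out so that the rules for composition with an affine map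
    apply. *)
Definition bump (x : R) : R := flat 1 (1 * x + 1) * flat 1 (-1 * x + 1).

Definition dbump : R -> R := derive1 bump.

Lemma nderivable_bump n : nderivable n bump.
Proof. by apply: nderivableM; apply: nderivable_comp_affine; exact: nderivable_flat. Qed.

Lemma is_derive_bump (x : R) : is_derive x 1 bump (dbump x).
Proof. apply: derivable_is_derive1; exact: nderivable_derivable (nderivable_bump 0). Qed.

Lemma dbumpE : dbump = fun x =>
  flat ('X^2 * (1^`() *- 1 + 1)) (1 * x + 1) * flat 1 (-1 * x + 1) +
  flat 1 (1 * x + 1) * (- flat ('X^2 * (1^`() *- 1 + 1)) (-1 * x + 1)).
Proof.
apply: derive1_funE => x.
have h1 := is_derive1_comp_affine (is_derive_flat 1 (1 * x + 1)).
have h2 := is_derive1_comp_affine (is_derive_flat 1 (-1 * x + 1)).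
by move/is_derive_eq: (is_derive1M h1 h2); apply; rewrite [1 * flat _ _]mul1r [-1 * flat _ _]mulN1r.
Qed.

Lemma bump_bounded : exists2 C : R, 0 <= C &
  forall x, `|bump x| <= C /\ `|dbump x| <= C.
Proof.
have [A A0 hA] := @flat_bounded R 1.
have [B B0 hB] := @flat_bounded R ('X^2 * (1^`() *- 1 + 1)).
exists (A * A + (B * A + A * B)); first by rewrite !addr_ge0 ?mulr_ge0.
move=> x; split.
  by rewrite normrM ler_wpDr ?addr_ge0 ?mulr_ge0// ler_pM.
rewrite dbumpE ler_wpDl ?mulr_ge0// (le_trans (ler_normD _ _))//.
by rewrite !normrM normrN lerD// ler_pM.
Qed.

Lemma bump_eq0 x : 1 <= `|x| -> bump x = 0.
Proof.
rewrite /bump mul1r mulN1r ler_normr => /orP[x1|x1].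
  by rewrite [X in _ * X]/flat ifF ?mulr0//; apply/negbTE; rewrite -leNgt; lra.
by rewrite /flat ifF ?mul0r//; apply/negbTE; rewrite -leNgt; lra.
Qed.

Lemma bump0_gt0 : 0 < bump 0.
Proof. by rewrite /bump !mulr0 add0r /flat ltr01 hornerC mul1r mulr_gt0 ?expR_gt0. Qed.

Lemma weak_derivative_measurable (tau dtau : R -> R) : weak_derivative tau dtau ->
  measurable_fun setT tau /\ measurable_fun setT dtau.
Proof. by move=> [[? _ _] [? _ _] _]. Qed.

(* Admissible test functions that approximate a multiple of the Gaussian density. *)
Definition gauss_cutoff n (x : R) : R := p x * bump (n.+1%:R^-1 * x + 0).

Lemma is_derive_gauss_cutoff n (x : R) : is_derive x 1 (gauss_cutoff n)
  (- x * p x * bump (n.+1%:R^-1 * x + 0) +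
   p x * (n.+1%:R^-1 * dbump (n.+1%:R^-1 * x + 0))).
Proof.
by apply: is_derive1M (is_derive_normal_pdf01 x) (is_derive1_comp_affine (is_derive_bump _)).
Qed.

Lemma closure_support_compact (f : R -> R) (M : R) :
  (forall x, M <= `|x| -> f x = 0) -> compact (closure [set x | f x != 0]).
Proof.
move=> f0; apply: (@subclosed_compact _ _ `[- M, M]).
- exact: closed_closure.
- exact: segment_compact.
- rewrite closureE => x /(_ [set` `[- M, M]]); apply; split; first exact: itv_closed.
  move=> y /= fy; rewrite in_itv/= -ler_norml leNgt.
  by apply/negP => My; move: fy; rewrite f0 ?eqxx// ltW.
Qed.

Lemma test_function_gauss_cutoff n : test_function (gauss_cutoff n).
Proof.
split.
  apply: nderivable_derive1n => k; apply: nderivableM.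
    exact: nderivable_normal_pdf01.
  apply: nderivable_comp_affine; exact: nderivable_bump.
apply: (@closure_support_compact _ n.+1%:R) => x xn.
rewrite /gauss_cutoff bump_eq0 ?mulr0// addr0 normrM ger0_norm ?invr_ge0//.
by rewrite mulrC ler_pdivlMr ?mul1r// ltr0n.
Qed.

(** The pointwise bounds |t| <= 1 + t^2 and |x t| <= x^2 + t^2 reduce everything to second
    moments. *)
Lemma integrable_moment1 (tau : R -> R) : measurable_fun setT tau ->
  mu.-integrable setT (fun x => (tau x ^+ 2 * p x)%:E) ->
  mu.-integrable setT (fun x => (tau x * p x)%:E) /\
  mu.-integrable setT (fun x => (x * tau x * p x)%:E).
Proof.
move=> mtau i2.
have mp := @measurable_normal_pdf01 R.
have hp := @normal_pdf01_gt0 R.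
split.
  apply: (@le_integrable_EFin _ _ (fun x => p x + tau x ^+ 2 * p x)).
  - exact: measurable_funM.
  - move=> x; rewrite normrM (gtr0_norm (hp x)).
    rewrite -[X in X + _]mul1r -mulrDl ler_wpM2r ?(ltW (hp x))//.
    have := sqr_ge0 (`|tau x| - 1); rewrite sqrrB1 real_normK ?num_real//.
    have := sqr_ge0 (tau x); have := normr_ge0 (tau x); lra.
  - exact: (integrableD measurableT (integrable_normal_pdf 0 1) i2).
apply: (@le_integrable_EFin _ _ (fun x => x ^+ 2 * p x + tau x ^+ 2 * p x)).
- by apply: measurable_funM => //; exact: measurable_funM.
- move=> x; rewrite normrM (gtr0_norm (hp x)) -mulrDl ler_wpM2r ?(ltW (hp x))//.
  rewrite normrM -(real_normK (num_real x)) -(real_normK (num_real (tau x))).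
  have := sqr_ge0 (`|x| - `|tau x|); have := normr_ge0 x; have := normr_ge0 (tau x).
  rewrite sqrrB; nra.
- exact: (integrableD measurableT (@integrable_sqr_normal_pdf01 R) i2).
Qed.

(** Testing the weak derivative against [gauss_cutoff n] and letting n grow replaces the cutoff by
    the constant [bump 0] on both sides; since p' = - x p, the left side becomes the moment of
    [x * tau x]. Positivity of [bump 0] allows it to be cancelled. *)
Lemma stein (tau dtau : R -> R) : weak_derivative tau dtau ->
  mu.-integrable setT (fun x => (tau x ^+ 2 * p x)%:E) ->
  mu.-integrable setT (fun x => (dtau x * p x)%:E) ->
  \int[mu]_x (x * tau x * p x) = \int[mu]_x (dtau x * p x).
Proof.
move=> wd i2 id.
have [mtau mdtau] := weak_derivative_measurable wd.
have [i0 i1] := integrable_moment1 mtau i2.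
have mp := @measurable_normal_pdf01 R.
have hp := @normal_pdf01_gt0 R.
have [C C0 hC] := bump_bounded.
have mbump : measurable_fun setT bump.
  exact: continuous_measurable_fun (is_derive1_continuous is_derive_bump).
have mdbump : measurable_fun setT dbump.
  apply: continuous_measurable_fun.
  apply: (@is_derive1_continuous _ _ (derive1 dbump)) => x.
  by apply: derivable_is_derive1; have [_ []] := nderivable_bump 1.
have maff n : measurable_fun setT (fun x : R => n.+1%:R^-1 * x + 0).
  by apply: measurable_funD => //; exact: measurable_funM.
have scale0 (x : R) : n.+1%:R^-1 * x + 0 @[n --> \oo] --> (0 : R).
  rewrite -[X in _ --> X](addr0 0); apply: cvgD; last exact: cvg_cst.
  rewrite -[X in _ --> X](mul0r x); apply: cvgM; last exact: cvg_cst.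
  exact: cvg_harmonic.
have bump_cvg (x : R) : bump (n.+1%:R^-1 * x + 0) @[n --> \oo] --> bump 0.
  apply: (cvg_comp _ _ (scale0 x)).
  exact: (is_derive1_continuous is_derive_bump).
have key n : \int[mu]_x (tau x * derive1 (gauss_cutoff n) x) =
    - \int[mu]_x (dtau x * gauss_cutoff n x).
  by have [_ _] := wd; apply; exact: test_function_gauss_cutoff.
have L2 : \int[mu]_x (dtau x * gauss_cutoff n x) @[n --> \oo] -->
    \int[mu]_x (bump 0 * (dtau x * p x)).
  apply: (@Rintegral_dominated_cvg _ _ _ (fun x => C * `|dtau x * p x|)).
  - move=> n; apply: measurable_funM => //; apply: measurable_funM => //.
    exact: measurableT_comp.
  - by apply: measurable_funM => //; apply: measurable_funM.
  - move=> x; rewrite [bump 0 * _]mulrC -mulrA.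
    by apply: cvgM; [exact: cvg_cst|]; apply: cvgM; [exact: cvg_cst|].
  - exact: (integrableZl measurableT C (integrable_norm id)).
  - move=> n x; rewrite /gauss_cutoff mulrA normrM mulrC ler_wpM2r//.
    by case: (hC (n.+1%:R^-1 * x + 0)).
have L1 : \int[mu]_x (tau x * derive1 (gauss_cutoff n) x) @[n --> \oo] -->
    \int[mu]_x ((- bump 0) * (x * tau x * p x)).
  apply: (@Rintegral_dominated_cvg _ _ _
    (fun x => C * `|x * tau x * p x| + C * `|tau x * p x|)).
  - move=> n; rewrite (derive1_funE (is_derive_gauss_cutoff n)).
    apply: measurable_funM => //; apply: measurable_funD.
      apply: measurable_funM; last exact: measurableT_comp.
      by apply: measurable_funM => //; exact: measurableT_comp.
    apply: measurable_funM => //; apply: measurable_funM => //.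
    exact: measurableT_comp.
  - by apply: measurable_funM => //; apply: measurable_funM => //; apply: measurable_funM.
  - move=> x.
    have -> : - bump 0 * (x * tau x * p x) =
        tau x * (- x * p x * bump 0 + p x * 0) by ring.
    have -> : (fun n => tau x * derive1 (gauss_cutoff n) x) = (fun n =>
        tau x * (- x * p x * bump (n.+1%:R^-1 * x + 0) +
                 p x * (n.+1%:R^-1 * dbump (n.+1%:R^-1 * x + 0)))).
      by apply/funext => n; rewrite (derive1_funE (is_derive_gauss_cutoff n)).
    apply: cvgM; first exact: cvg_cst.
    apply: cvgD; apply: cvgM => //; try exact: cvg_cst.
    (* Differentiating the rescaled bump produces the factor [n.+1%:R^-1], so this term disappears
       in the limit. *)
    apply/norm_cvg0P; apply: (@squeeze_cvgr _ _ _ _ (cst 0) (fun n => n.+1%:R^-1 * C)).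
    + apply: nearW => n; rewrite normr_ge0/= normrM ger0_norm ?invr_ge0//.
      by rewrite ler_wpM2l ?invr_ge0//; case: (hC (n.+1%:R^-1 * x + 0)).
    + exact: cvg_cst.
    + rewrite -[X in _ --> X](mul0r C); apply: cvgM; last exact: cvg_cst.
      exact: cvg_harmonic.
  - exact: (integrableD measurableT (integrableZl measurableT C (integrable_norm i1))
      (integrableZl measurableT C (integrable_norm i0))).
  - move=> n x; rewrite (derive1_funE (is_derive_gauss_cutoff n)).
    have [b1 b2] := hC (n.+1%:R^-1 * x + 0).
    (* Regrouped so that each summand is a uniformly bounded factor times an integrable moment. *)
    have -> : tau x * (- x * p x * bump (n.+1%:R^-1 * x + 0) +
       p x * (n.+1%:R^-1 * dbump (n.+1%:R^-1 * x + 0))) =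
       bump (n.+1%:R^-1 * x + 0) * - (x * tau x * p x) +
       (n.+1%:R^-1 * dbump (n.+1%:R^-1 * x + 0)) * (tau x * p x) by ring.
    rewrite (le_trans (ler_normD _ _))// lerD//.
      by rewrite normrM normrN ler_wpM2r.
    rewrite normrM ler_wpM2r// normrM ger0_norm ?invr_ge0//.
    by rewrite (le_trans _ b2)// ler_piMl// invf_le1 ?ltr0n// ler1n.
have : \int[mu]_x ((- bump 0) * (x * tau x * p x)) =
    - \int[mu]_x (bump 0 * (dtau x * p x)).
  apply: (cvg_unique _ L1) => //.
  by rewrite (funext key); exact: cvgN.
rewrite !RintegralZl// mulNr => /oppr_inj /mulfI; apply.
by rewrite gt_eqF// bump0_gt0.
Qed.

End stein.

(** * Integrals over intervals, supports and symmetric functions *)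

Section integral_tools.
Context {R : realType}.
Local Notation mu := (@lebesgue_measure R).

Lemma continuous_integrable_itv (f : R -> R) (a b : R) : continuous f ->
  mu.-integrable `[a, b] (EFin \o f).
Proof.
move=> cf; apply: continuous_compact_integrable; first exact: segment_compact.
exact: continuous_subspaceT.
Qed.

Lemma Rintegral_FTC (F f : R -> R) (a b : R) : a <= b ->
  (forall x : R, is_derive x 1 F (f x)) -> continuous f ->
  \int[mu]_(x in `[a, b]) f x = F b - F a.
Proof.
rewrite le_eqVlt => /predU1P[->|ab] Ff cf.
  by rewrite set_itv1 Rintegral_set1 subrr.
have cF := is_derive1_continuous Ff.
rewrite /Rintegral (@continuous_FTC2 _ f F)//.
- exact: continuous_subspaceT.
- split.
  + by move=> x _; case: (Ff x).
  + by apply: cvg_at_right_filter; exact: cF.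
  + by apply: cvg_at_left_filter; exact: cF.
- by move=> x _; rewrite (derive1_funE Ff).
Qed.

Lemma Rintegral_itv_split (f : R -> R) (a b c : R) : a <= b -> b <= c ->
  mu.-integrable `[a, c] (EFin \o f) ->
  \int[mu]_(x in `[a, c]) f x =
  \int[mu]_(x in `[a, b]) f x + \int[mu]_(x in `[b, c]) f x.
Proof.
move=> ab bc fi.
have := @Rintegral_itvB _ f (BLeft a) (BRight c) b fi ab bc.
rewrite Rintegral_itv_obnd_cbnd => [<-|]; first by rewrite addrC subrK.
by apply: integrableS fi => //; apply: subset_itv; rewrite bnd_simp.
Qed.

Lemma Rintegral_support (f : R -> R) (D : set R) :
  (forall x, ~ D x -> f x = 0) ->
  \int[mu]_x f x = \int[mu]_(x in D) f x.
Proof.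
move=> f0; rewrite [RHS]Rintegral_mkcond; apply: eq_Rintegral => x _.
by rewrite patchE; case: ifPn => // /negP; rewrite inE => /f0.
Qed.

(** Lebesgue measure is invariant under reflection, so the integral equals its own opposite. *)
Lemma Rintegral_odd (f : R -> R) : measurable_fun setT f ->
  mu.-integrable setT (EFin \o f) -> (forall x, f (- x) = - f x) ->
  \int[mu]_x f x = 0.
Proof.
move=> mf fi fodd.
have mN : measurable_fun setT (-%R : measurableTypeR R -> measurableTypeR R).
  exact: oppr_measurable.
have fiN : mu.-integrable (-%R @^-1` setT) ((EFin \o f) \o (-%R : R -> R)).
  rewrite preimage_setT (_ : _ \o _ = EFin \o (fun x => (-1) * f x)).
    exact: (integrableZl measurableT (-1) fi).
  by apply/funext => x /=; rewrite fodd mulN1r.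
have mEf : measurable_fun [set: measurableTypeR R] (EFin \o f).
  by apply/measurable_EFinP.
have h := @integral_pushforward _ _ (measurableTypeR R) (measurableTypeR R) R
  -%R mN mu setT (EFin \o f) mEf fiN measurableT.
have e : (\int[pushforward mu (-%R : measurableTypeR R -> measurableTypeR R)]_y (EFin \o f) y
   = \int[mu]_y (EFin \o f) y)%E.
  by apply: eq_measure_integral => A mA _; exact: lebesgue_measureN.
rewrite e preimage_setT in h.
have : \int[mu]_x f x = \int[mu]_x ((-1) * f x).
  rewrite {1}/Rintegral h /Rintegral; congr fine; apply: eq_integral => x _ /=.
  by rewrite fodd mulN1r.
by rewrite RintegralZl// mulN1r => /esym/eqP; rewrite eqNr => /eqP.
Qed.

End integral_tools.

(** * The rescaled error function as a Gaussian probability *)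

Section scaled_erf.
Context {R : realType}.
Local Notation mu := (@lebesgue_measure R).
Local Notation p := (@normal_pdf R 0 1).

(* [erf_sqrt2 s] is P(|Z| <= s) for s >= 0, and its derivative is [2 * p s]. *)
Definition erf_sqrt2 (s : R) : R := erf (s / Num.sqrt 2).

(** Both branches of the oriented integral equal [G x - G 0] for the primitive [G] starting at minus
    infinity, so 0 needs no separate treatment. *)
Lemma is_derive_erf (t : R) : is_derive t 1 erf (2 / Num.sqrt pi * gauss_fun t).
Proof.
have ig (A : set R) : measurable A -> mu.-integrable A (EFin \o gauss_fun).
  by move=> mA; apply: integrableS (@integrableT_gauss R).
pose G (x : R) := \int[mu]_(u in `]-oo, x]) gauss_fun u.
have dG (x : R) : is_derive x 1 G (gauss_fun x).
  have [||//||dG G'] := @continuous_FTC1 R gauss_fun -oo%O x (x + 1).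
  - by rewrite ltrDl.
  - exact: ig.
  - by rewrite ltNyr.
  - exact: continuous_gauss_fun.
  by apply: DeriveDef; [exact: dG | rewrite -derive1E; exact: G'].
have GB (a b : R) : a <= b -> \int[mu]_(u in `[a, b]) gauss_fun u = G b - G a.
  move=> ab; rewrite /G (@Rintegral_itvB _ gauss_fun -oo%O (BRight b) a)//.
  - by rewrite Rintegral_itv_obnd_cbnd//; exact: ig.
  - exact: ig.
have -> : erf = fun x : R => 2 / Num.sqrt pi * (G x - G 0).
  apply/funext => x; rewrite /erf; congr (_ * _); case: ifPn => x0.
    by rewrite GB.
  by rewrite GB ?opprB// ltW// ltNge.
apply: is_derive1Ml; rewrite -[X in is_derive _ _ _ X]subr0.
exact: is_derive1B (dG t) (is_derive_cst _ _ _).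
Qed.

Lemma is_derive_erf_sqrt2 (s : R) : is_derive s 1 erf_sqrt2 (2 * p s).
Proof.
have s2 : Num.sqrt 2 != 0 :> R by rewrite gt_eqF// sqrtr_gt0.
have spi : Num.sqrt pi != 0 :> R by rewrite gt_eqF// sqrtr_gt0 pi_gt0.
have h := is_derive1_comp_affine (is_derive_erf ((Num.sqrt 2)^-1 * s + 0)).
rewrite (_ : erf_sqrt2 = fun y => erf ((Num.sqrt 2)^-1 * y + 0)); last first.
  by apply/funext => y; rewrite /erf_sqrt2 addr0 mulrC.
move/is_derive_eq: h; apply.
rewrite normal_pdf01E /gauss_fun /normal_peak addr0 exprMn exprVn sqr_sqrtr//.
rewrite expr1n mul1r -(mulr_natr pi) sqrtrM ?pi_ge0//.
rewrite [_^-1 * s ^+ 2]mulrC; field.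
by rewrite s2 spi.
Qed.

Lemma erf_sqrt2_0 : erf_sqrt2 0 = 0.
Proof. by rewrite /erf_sqrt2 mul0r /erf lexx set_itv1 Rintegral_set1 mulr0. Qed.

Lemma normal_pdf01N (x : R) : p (- x) = p x.
Proof. by rewrite normal_pdf01E/= sqrrN. Qed.

(** The sum of both sides' error functions has derivative 0, by evenness of [p], and vanishes at
    0. *)
Lemma erf_sqrt2N (s : R) : erf_sqrt2 (- s) = - erf_sqrt2 s.
Proof.
have h (x : R) : is_derive x 1 (fun y => erf_sqrt2 (-1 * y + 0) + erf_sqrt2 y) 0.
  have := is_derive1D (is_derive1_comp_affine (is_derive_erf_sqrt2 (-1 * x + 0))) (is_derive_erf_sqrt2 x).
  by move/is_derive_eq; apply; rewrite addr0 mulN1r normal_pdf01N; ring.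
have := is_derive_0_is_cst s 0 h.
by rewrite !mulN1r !addr0 oppr0 erf_sqrt2_0 addr0 => /eqP; rewrite addr_eq0 => /eqP.
Qed.

Lemma continuous_normal_pdf01 : continuous p.
Proof. exact: is_derive1_continuous (@is_derive_normal_pdf01 R). Qed.

Lemma continuous_erf_sqrt2 : continuous erf_sqrt2.
Proof. exact: is_derive1_continuous is_derive_erf_sqrt2. Qed.

Lemma integral_pdf_itv (a b : R) : a <= b ->
  \int[mu]_(x in `[a, b]) p x = (erf_sqrt2 b - erf_sqrt2 a) / 2.
Proof.
have h (x : R) : is_derive x 1 (fun y => 2^-1 * erf_sqrt2 y) (p x).
  by apply: is_derive_eq (is_derive1Ml 2^-1 (is_derive_erf_sqrt2 x)) _; field.
by move=> ab; rewrite (Rintegral_FTC ab h continuous_normal_pdf01) -mulrBr mulrC.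
Qed.

Lemma integral_sqr_pdf_itv (a b : R) : a <= b ->
  \int[mu]_(x in `[a, b]) (x ^+ 2 * p x) = (erf_sqrt2 b - erf_sqrt2 a) / 2 - (b * p b - a * p a).
Proof.
have h (x : R) : is_derive x 1 (fun y => 2^-1 * erf_sqrt2 y - y * p y) (x ^+ 2 * p x).
  have := is_derive1B (is_derive1Ml 2^-1 (is_derive_erf_sqrt2 x))
    (is_derive1M (is_derive_id x 1) (is_derive_normal_pdf01 x)).
  by move/is_derive_eq; apply; field.
have c : continuous (fun x : R => x ^+ 2 * p x).
  by move=> x; apply: cvgM; [exact: exprn_continuous | exact: continuous_normal_pdf01].
by move=> ab; rewrite (Rintegral_FTC ab h c); field.
Qed.

Lemma erf_sqrt2_integral (s : R) : 0 <= s -> erf_sqrt2 s = \int[mu]_(x in `[- s, s]) p x.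
Proof. by move=> s0; rewrite integral_pdf_itv ?erf_sqrt2N; [field|lra]. Qed.

Lemma erf_sqrt2_mono : {homo erf_sqrt2 : x y / x < y}.
Proof.
move=> x y xy.
have h1 z : z \in `]x, y[ -> derivable erf_sqrt2 z 1 by move=> _; case: (is_derive_erf_sqrt2 z).
have h2 z : z \in `]x, y[ -> 0 < derive1 erf_sqrt2 z.
  by move=> _; rewrite (derive1_funE is_derive_erf_sqrt2) mulr_gt0 ?normal_pdf01_gt0.
exact: (gtr0_derive1_incr h1 h2 (continuous_subspaceT continuous_erf_sqrt2) (lexx x) xy (lexx y)).
Qed.

Lemma Rintegral_pdf : \int[mu]_x p x = 1.
Proof. by rewrite /Rintegral integral_normal_pdf. Qed.

(** [erf_sqrt2 n%:R] is the Gaussian mass of [-n, n]; the density itself dominates its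
    restrictions. *)
Lemma erf_sqrt2_cvg1 : erf_sqrt2 n%:R @[n --> \oo] --> (1 : R).
Proof.
rewrite -[X in _ --> X]Rintegral_pdf.
rewrite (_ : (fun n => erf_sqrt2 n%:R) = fun n => \int[mu]_x (p \_ `[- n%:R, n%:R]) x).
  apply: (@Rintegral_dominated_cvg _ _ _ p).
  - move=> n; apply/(measurable_restrictT _ _).1 => //.
    by apply: measurable_funTS; exact: measurable_normal_pdf01.
  - exact: measurable_normal_pdf01.
  - move=> x; apply: cvg_near_cst; near=> n.
    rewrite patchE mem_set//= in_itv/= -ler_norml.
    by near: n; exact: nbhs_infty_ger.
  - exact: integrable_normal_pdf.
  - move=> n x; rewrite patchE; case: ifPn => _; rewrite ?normr0 ?normal_pdf_ge0//.
    by rewrite ger0_norm ?normal_pdf_ge0.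
apply/funext => n; rewrite erf_sqrt2_integral// -Rintegral_mkcond//.
Unshelve. all: by end_near. Qed.

(** A value of at least 1 would by strict growth put the value at [s + 1], and all later ones, above
    the limit 1. *)
Lemma erf_sqrt2_lt1 (s : R) : erf_sqrt2 s < 1.
Proof.
rewrite ltNge; apply/negP => Es.
have E1 : 1 < erf_sqrt2 (s + 1) by apply: (le_lt_trans Es); apply: erf_sqrt2_mono; rewrite ltrDl.
have [n] : exists n : nat, erf_sqrt2 n%:R < erf_sqrt2 (s + 1) /\ s + 1 <= n%:R.
  near \oo => n; exists n; split; near: n; last exact: nbhs_infty_ger.
  exact: cvgr_lt erf_sqrt2_cvg1 _ E1.
by case=> + /(ltW_homo erf_sqrt2_mono); rewrite ltNge => /negP.
Unshelve. all: by end_near. Qed.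

Lemma erf_sqrt2_gt (e : R) : e < 1 -> exists2 M : R, 0 <= M & e < erf_sqrt2 M.
Proof.
move=> e1; near \oo => n; exists n%:R => //.
by near: n; exact: cvgr_gt erf_sqrt2_cvg1 _ e1.
Unshelve. all: by end_near. Qed.


End scaled_erf.

(** * Weak derivative and moments of clipped linear functions *)

Section clip.
Context {R : realType}.
Local Notation mu := (@lebesgue_measure R).
Local Notation p := (@normal_pdf R 0 1).
Implicit Types (s b c x : R) (phi : R -> R).

Lemma continuous_locally_integrable (f : R -> R) : continuous f ->
  locally_integrable setT f.
Proof.
move=> cf; split; [exact: continuous_measurable_fun | exact: openT | move=> K _ cK].
have /integrableP[_] := @continuous_compact_integrable R f K cK (continuous_subspaceT cf).
by [].
Qed.

Lemma test_function_is_derive phi : test_function phi ->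
  (forall x, is_derive x 1 phi (derive1 phi x)) /\ continuous (derive1 phi).
Proof.
move=> [/derive1n_nderivable/(_ 1%N)[dphi [ddphi _]] _]; split.
  by move=> x; exact: derivable_is_derive1.
apply: (@is_derive1_continuous _ _ (derive1 (derive1 phi))) => x.
exact: derivable_is_derive1.
Qed.

(** Having [M] beyond the modulus of [s] puts both kinks of [clip s] inside the interval of
    integration. The derivative vanishes too, because [phi] is zero near each such point. *)
Lemma test_function_support phi s : test_function phi ->
  exists2 M : R, `|s| < M & forall x, M <= `|x| -> phi x = 0 /\ derive1 phi x = 0.
Proof.
move=> [_ cphi].
have [A [Ar hA]] := compact_bounded cphi.
(* [compact_bounded] bounds the support by every number strictly above [A], hence the [+ 1]; the
   maximum with 0 makes [B] positive. *)
pose B := Num.max A 0 + 1; have AB : A < B by rewrite /B ltr_pwDr// le_max lexx.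
have B0 : 0 < B by rewrite /B ltr_wpDl// le_max lexx orbT.
have phi0 x : B < `|x| -> phi x = 0.
  move=> Bx; apply/eqP/negPn/negP => phix.
  have /= := hA _ AB x (@subset_closure _ [set x | phi x != 0] x phix).
  by rewrite leNgt Bx.
exists (B + `|s| + 1); first by lra.
move=> x Mx; have Bx : B < `|x| by have := normr_ge0 s; lra.
split; first exact: phi0.
rewrite derive1E -(derive_cst (0 : R) x 1); apply: near_eq_derive.
near=> y; apply: phi0.
near: y; apply: (@cvgr_gt _ _ _ _ (fun y : R => `|y|) `|x|) => //.
exact: norm_continuous.
Unshelve. all: by end_near. Qed.

(** Integration by parts in the one case required: each piece of a clipped function is affine. *)
Lemma Rintegral_affine_derive phi (k m a b : R) : test_function phi -> a <= b ->
  \int[mu]_(x in `[a, b]) ((k + m * x) * derive1 phi x) =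
  (k + m * b) * phi b - (k + m * a) * phi a - m * \int[mu]_(x in `[a, b]) phi x.
Proof.
move=> tphi ab; have [dphi cdphi] := test_function_is_derive tphi.
have cphi := is_derive1_continuous dphi.
have ca : continuous (fun x : R => k + m * x).
  by move=> x; apply: cvgD; [exact: cvg_cst | apply: cvgM; [exact: cvg_cst | exact: cvg_id]].
have c1 : continuous (fun x => (k + m * x) * derive1 phi x).
  by move=> x; apply: cvgM; [exact: ca | exact: cdphi].
have c2 : continuous (fun x => m * phi x).
  by move=> x; apply: cvgM; [exact: cvg_cst | exact: cphi].
have h x : is_derive x 1 (fun y => (k + m * y) * phi y)
    ((k + m * x) * derive1 phi x + m * phi x).
  have := is_derive1M (is_derive1D (is_derive_cst k x 1)
    (is_derive1Ml m (is_derive_id x 1))) (dphi x).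
  by move/is_derive_eq; apply; rewrite add0r mulr1 addrC.
have c3 : continuous (fun x => (k + m * x) * derive1 phi x + m * phi x).
  by move=> x; apply: cvgD; [exact: c1 | exact: c2].
rewrite -(Rintegral_FTC ab h c3) RintegralD//; try exact: continuous_integrable_itv.
by rewrite RintegralZl ?addrK//; exact: continuous_integrable_itv.
Qed.

Definition clip s x : R := Num.min (Num.max x (- s)) s.

Lemma clip_id s x : - s <= x <= s -> clip s x = x.
Proof. by move=> /andP[h1 h2]; rewrite /clip max_l// min_l. Qed.

Lemma clip_ge s x : 0 <= s -> s <= x -> clip s x = s.
Proof. by move=> s0 sx; rewrite /clip max_l ?min_r//; lra. Qed.

Lemma clip_le s x : 0 <= s -> x <= - s -> clip s x = - s.
Proof. by move=> s0 sx; rewrite /clip max_r// min_l//; lra. Qed.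

Lemma continuous_clip s : continuous (clip s).
Proof.
move=> x.
have cmax : {for x, continuous ((fun y : R => y : R^o) \max cst (- s))}.
  by apply: continuous_max; [exact: cvg_id | exact: cvg_cst].
exact: (continuous_min cmax (cvg_cst s)).
Qed.

Lemma clipN s x : 0 <= s -> clip s (- x) = - clip s x.
Proof.
move=> s0; have [h1|h1] := leP x (- s).
  by rewrite (clip_le s0 h1) clip_ge ?opprK//; lra.
have [h2|h2] := leP s x.
  by rewrite (clip_ge s0 h2) clip_le//; lra.
by rewrite !clip_id//; apply/andP; split; lra.
Qed.

(** Serves the infinite threshold, where clipping is the identity. *)
Lemma weak_derivative_affine (c b : R) :
  weak_derivative (fun x => c + b * x) (cst b).
Proof.
split; try apply: continuous_locally_integrable.
- by move=> x; apply: cvgD; [exact: cvg_cst | apply: cvgM; [exact: cvg_cst | exact: cvg_id]].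
- by move=> x; exact: cvg_cst.
move=> phi tphi; have [M] := test_function_support 0 tphi.
rewrite normr0 => M0 hM.
rewrite !(@Rintegral_support _ _ `[- M, M]); first last.
- move=> x /=; rewrite in_itv/= -ler_norml => /negP; rewrite -ltNge => /ltW/hM[_ ->].
  by rewrite mulr0.
- move=> x /=; rewrite in_itv/= -ler_norml => /negP; rewrite -ltNge => /ltW/hM[-> _].
  by rewrite mulr0.
have [dphi _] := test_function_is_derive tphi.
have cphi := is_derive1_continuous dphi.
rewrite Rintegral_affine_derive//; last by lra.
have [-> _] : phi M = 0 /\ derive1 phi M = 0 by apply: hM; rewrite gtr0_norm.
have [-> _] : phi (- M) = 0 /\ derive1 phi (- M) = 0.
  by apply: hM; rewrite normrN gtr0_norm.
rewrite !mulr0 subr0 sub0r RintegralZl//; exact: continuous_integrable_itv.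
Qed.

(** Integrate by parts on the three affine pieces. The boundary terms at the kinks cancel by
    continuity, those at the outer ends vanish with [phi], and only the middle piece has a
    nonconstant integrand factor. *)
Lemma weak_derivative_clip (c b s : R) : 0 <= s ->
  weak_derivative (fun x => c + b * clip s x) (fun x => b * \1_(`[- s, s]) x).
Proof.
move=> s0.
have csig : continuous (fun x => c + b * clip s x).
  by move=> x; apply: cvgD; [exact: cvg_cst |
    apply: cvgM; [exact: cvg_cst | exact: continuous_clip]].
split.
- exact: continuous_locally_integrable.
- apply: open_integrable_locally; first exact: openT.
  exact: (integrableZl measurableT b (@integrable_indic_itv R (- s) s true false)).
move=> phi tphi; have [M] := test_function_support s tphi.
rewrite ger0_norm// => sM hM.
have [dphi cdphi] := test_function_is_derive tphi.
have cphi := is_derive1_continuous dphi.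
have cM : continuous (fun x => (c + b * clip s x) * derive1 phi x).
  by move=> x; apply: cvgM; [exact: csig | exact: cdphi].
rewrite (@Rintegral_support _ _ `[- M, M]); last first.
  move=> x /=; rewrite in_itv/= -ler_norml => /negP; rewrite -ltNge => /ltW/hM[_ ->].
  by rewrite mulr0.
rewrite [in RHS](@Rintegral_support _ _ `[- s, s]); last first.
  by move=> x xs; rewrite indicE memNset// mulr0 mul0r.
rewrite (@Rintegral_itv_split _ _ (- M) (- s) M); try exact: continuous_integrable_itv; try lra.
rewrite (@Rintegral_itv_split _ _ (- s) s M); try exact: continuous_integrable_itv; try lra.
(* The constant pieces carry a slope [0 * x] so that the rule for affine functions applies to all
   three. *)
have -> : \int[mu]_(x in `[- M, - s]) ((c + b * clip s x) * derive1 phi x) =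
    \int[mu]_(x in `[- M, - s]) ((c - b * s + 0 * x) * derive1 phi x).
  apply: eq_Rintegral => x; rewrite inE/= in_itv/= => /andP[_ xs].
  by rewrite clip_le//; congr (_ * _); ring.
have -> : \int[mu]_(x in `[- s, s]) ((c + b * clip s x) * derive1 phi x) =
    \int[mu]_(x in `[- s, s]) ((c + b * x) * derive1 phi x).
  by apply: eq_Rintegral => x; rewrite inE/= in_itv/= => xs; rewrite clip_id.
have -> : \int[mu]_(x in `[s, M]) ((c + b * clip s x) * derive1 phi x) =
    \int[mu]_(x in `[s, M]) ((c + b * s + 0 * x) * derive1 phi x).
  apply: eq_Rintegral => x; rewrite inE/= in_itv/= => /andP[xs _].
  by rewrite clip_ge//; congr (_ * _); ring.
rewrite !Rintegral_affine_derive//; try lra.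
have [-> _] : phi M = 0 /\ derive1 phi M = 0 by apply: hM; rewrite ger0_norm; lra.
have [-> _] : phi (- M) = 0 /\ derive1 phi (- M) = 0.
  by apply: hM; rewrite normrN ger0_norm; lra.
have -> : \int[mu]_(x in `[- s, s]) (b * \1_(`[- s, s]) x * phi x) =
    \int[mu]_(x in `[- s, s]) (b * phi x).
  by apply: eq_Rintegral => x xs; rewrite indicE xs mulr1.
rewrite RintegralZl//; last exact: continuous_integrable_itv.
ring.
Qed.

Lemma bounded_pdf_integrable (f : R -> R) (C : R) : measurable_fun setT f ->
  (forall x, `|f x| <= C) -> mu.-integrable setT (fun x => (f x * p x)%:E).
Proof.
move=> mf fC.
apply: (@le_integrable_EFin _ (fun x => f x * p x) (fun x => C * p x)).
- by apply: measurable_funM => //; exact: measurable_normal_pdf01.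
- by move=> x; rewrite normrM (gtr0_norm (normal_pdf01_gt0 x)) ler_wpM2r ?normal_pdf_ge0.
- exact: (integrableZl measurableT C (integrable_normal_pdf 0 1)).
Qed.

Lemma clip_bounded s x : 0 <= s -> `|clip s x| <= s.
Proof.
move=> s0; rewrite ler_norml /clip le_min ge_min lexx orbT andbT.
by rewrite le_max lexx orbT/=; lra.
Qed.

Lemma measurable_clip s : measurable_fun setT (clip s).
Proof. exact: continuous_measurable_fun (@continuous_clip s). Qed.

Lemma integral_clip s : 0 <= s -> \int[mu]_x (clip s x * p x) = 0.
Proof.
move=> s0; apply: Rintegral_odd.
- by apply: measurable_funM; [exact: measurable_clip | exact: measurable_normal_pdf01].
- apply: (@bounded_pdf_integrable _ s); first exact: measurable_clip.
  by move=> x; exact: clip_bounded.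
- by move=> x; rewrite clipN// normal_pdf01N mulNr.
Qed.

Lemma integral_sqr_clip s : 0 <= s ->
  \int[mu]_x (clip s x ^+ 2 * p x) = erf_sqrt2 s - s * (2 * p s) + s ^+ 2 * (1 - erf_sqrt2 s).
Proof.
move=> s0.
have mc2 : measurable_fun setT (fun x => clip s x ^+ 2).
  by apply: measurable_funX; exact: measurable_clip.
have c2 x : clip s x ^+ 2 <= s ^+ 2.
  by rewrite -(real_normK (num_real (clip s x))) lerXn2r ?nnegrE// clip_bounded.
(* Subtracting the tail value [s ^+ 2] leaves an integrand supported in [-s, s], so the unbounded
   part only involves the total mass 1. *)
have -> : \int[mu]_x (clip s x ^+ 2 * p x) =
    \int[mu]_x (s ^+ 2 * p x + (clip s x ^+ 2 - s ^+ 2) * p x).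
  by apply: eq_Rintegral => x _; ring.
have i1 : mu.-integrable setT (fun x => (s ^+ 2 * p x)%:E).
  exact: (integrableZl measurableT (s ^+ 2) (integrable_normal_pdf 0 1)).
have i2 : mu.-integrable setT (fun x => ((clip s x ^+ 2 - s ^+ 2) * p x)%:E).
  apply: (@bounded_pdf_integrable _ (s ^+ 2)); first exact: measurable_funB.
  move=> x; rewrite ler_norml; have := c2 x; have := sqr_ge0 (clip s x).
  by move=> h1 h2; apply/andP; split; lra.
rewrite RintegralD// RintegralZl//; last exact: integrable_normal_pdf.
rewrite Rintegral_pdf (@Rintegral_support _ (fun x => (clip s x ^+ 2 - s ^+ 2) * p x) `[- s, s]); last first.
  move=> x /= /negP; rewrite in_itv/= negb_and -!ltNge => /orP[xs|xs].
    by rewrite clip_le ?sqrrN ?subrr ?mul0r// ltW.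
  by rewrite clip_ge ?subrr ?mul0r// ltW.
have -> : \int[mu]_(x in `[- s, s]) ((clip s x ^+ 2 - s ^+ 2) * p x) =
    \int[mu]_(x in `[- s, s]) (x ^+ 2 * p x - s ^+ 2 * p x).
  by apply: eq_Rintegral => x; rewrite inE/= in_itv/= => xs; rewrite clip_id// mulrBl.
have cx2 : continuous (fun x : R => x ^+ 2 * p x).
  by move=> x; apply: cvgM; [exact: exprn_continuous | exact: continuous_normal_pdf01].
have cs2 : continuous (fun x : R => s ^+ 2 * p x).
  by move=> x; apply: cvgM; [exact: cvg_cst | exact: continuous_normal_pdf01].
have sN : - s <= s by lra.
rewrite RintegralB//; try exact: continuous_integrable_itv.
rewrite RintegralZl//; last exact: (continuous_integrable_itv _ _ continuous_normal_pdf01).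
by rewrite -(erf_sqrt2_integral s0) integral_sqr_pdf_itv// erf_sqrt2N normal_pdf01N; field.
Qed.

End clip.

(** * Monotonicity, limit at 0 and range of the reciprocal of g *)

Section reciprocal_of_g.
Context {R : realType}.
Local Notation p := (@normal_pdf R 0 1).
Implicit Types s t c : R.

(** Strictness makes the limit [(pi - 2) / 2] positive; equality is excluded by the irrationality of
    [pi]. *)
Lemma pi_gt2 : 2 < pi :> R.
Proof.
rewrite lt_neqAle pi_ge2 andbT; apply/eqP => pi2; apply: (@pi_irrationnal R).
by rewrite -pi2; apply/rationalP; exists 2, 1%N; rewrite divr1.
Qed.

(* [ginv_num / erf_sqrt2 ^+ 2] is [1 / g] away from 0. *)
Definition ginv_num s : R := (1 - erf_sqrt2 s) * (s ^+ 2 + erf_sqrt2 s) - s * (2 * p s).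

Definition ginv s : R := ginv_num s / erf_sqrt2 s ^+ 2.

Lemma double_pdf s : 2 * p s = Num.sqrt (2 / pi) / expR (s ^+ 2 / 2).
Proof.
have s2 : Num.sqrt 2 != 0 :> R by rewrite gt_eqF// sqrtr_gt0.
have spi : Num.sqrt pi != 0 :> R by rewrite gt_eqF// sqrtr_gt0 pi_gt0.
rewrite normal_pdf01E /normal_peak expRN expr1n mul1r -(mulr_natr pi).
rewrite sqrtrM ?pi_ge0// sqrtrM// sqrtrV ?pi_ge0//.
have e2 : 2 = Num.sqrt 2 * Num.sqrt 2 :> R by rewrite -expr2 sqr_sqrtr.
rewrite [X in X * _]e2; field.
by rewrite spi s2 gt_eqF ?expR_gt0.
Qed.

(** Factor the exponential out of the denominator. The identity includes [s = 0], where division by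
    zero makes both sides 0. *)
Lemma g_ginv s : g s = (ginv s)^-1.
Proof.
have e0 : expR (s ^+ 2 / 2) != 0 by rewrite gt_eqF// expR_gt0.
rewrite /g /ginv invf_div /ginv_num double_pdf -/(erf_sqrt2 s).
have -> : expR (s ^+ 2 / 2) * (1 - erf_sqrt2 s) * (s ^+ 2 + erf_sqrt2 s) - Num.sqrt (2 / pi) * s =
  expR (s ^+ 2 / 2) * ((1 - erf_sqrt2 s) * (s ^+ 2 + erf_sqrt2 s) - s * (Num.sqrt (2 / pi) / expR (s ^+ 2 / 2))).
  by field.
by rewrite invfM mulrACA divff// mul1r.
Qed.

Lemma erf_sqrt2_gt0 s : 0 < s -> 0 < erf_sqrt2 s.
Proof. by move=> s0; rewrite -(@erf_sqrt2_0 R); exact: erf_sqrt2_mono. Qed.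

Lemma erf_sqrt2_lt0 s : s < 0 -> erf_sqrt2 s < 0.
Proof. by move=> s0; rewrite -(@erf_sqrt2_0 R); exact: erf_sqrt2_mono. Qed.

Lemma erf_sqrt2_neq0 s : s != 0 -> erf_sqrt2 s != 0.
Proof. by rewrite neq_lt => /orP[/erf_sqrt2_lt0/lt_eqF->|/erf_sqrt2_gt0/gt_eqF->]. Qed.

Lemma is_derive_ginv_num s :
  is_derive s 1 ginv_num (2 * s * (1 - erf_sqrt2 s) - 2 * (2 * p s) * erf_sqrt2 s).
Proof.
have hE := is_derive_erf_sqrt2 s.
have h1 := is_derive1B (is_derive_cst (1 : R) s 1) hE.
have h2 := is_derive1D (is_deriveX 2 (is_derive_id s 1)) hE.
have h3 := is_derive1M (is_derive_id s 1) (is_derive1Ml 2 (is_derive_normal_pdf01 s)).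
move/is_derive_eq: (is_derive1B (is_derive1M h1 h2) h3); apply.
by rewrite /GRing.scale/= /cst !fctE /=; ring.
Qed.

Lemma is_derive_sqr_erf_sqrt2 s : is_derive s 1 (fun x => erf_sqrt2 x ^+ 2) (2 * erf_sqrt2 s * (2 * p s)).
Proof. by apply: is_derive_eq (is_deriveX 2 (is_derive_erf_sqrt2 s)) _; rewrite /GRing.scale/=; ring. Qed.

Lemma is_derive_ginv s : s != 0 -> is_derive s 1 ginv
  (2 * (erf_sqrt2 s - s * (2 * p s)) * (s * (1 - erf_sqrt2 s) - 2 * p s) / erf_sqrt2 s ^+ 3).
Proof.
move=> s0; have En0 := erf_sqrt2_neq0 s0; have E2n0 : erf_sqrt2 s ^+ 2 != 0 by rewrite expf_neq0.
have := is_derive1M (is_derive_ginv_num s) 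
  (@is_derive1V _ (fun x => erf_sqrt2 x ^+ 2) s _ E2n0 (is_derive_sqr_erf_sqrt2 s)).
by move/is_derive_eq; apply; rewrite /ginv_num; field.
Qed.

(** The difference [K] has positive derivative and is below [1 - erf_sqrt2], which tends to 0. So
    [K] is nonpositive, and comparing [s] with [s + 1] makes this strict. *)
Lemma mills_ratio_lt s : 0 < s -> s * (1 - erf_sqrt2 s) < 2 * p s.
Proof.
pose K (x : R) := (1 - erf_sqrt2 x) - 2 * p x * x^-1.
have dK (x : R) : 0 < x -> is_derive x 1 K (2 * p x / x ^+ 2).
  move=> x0; have xn0 : x != 0 by rewrite gt_eqF.
  have h1 := is_derive1B (is_derive_cst (1 : R) x 1) (is_derive_erf_sqrt2 x).
  have h2 := is_derive1M (is_derive1Ml 2 (is_derive_normal_pdf01 x))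
    (@is_derive1V _ id x 1 xn0 (is_derive_id x 1)).
  by move/is_derive_eq: (is_derive1B h1 h2); apply; rewrite /=; field.
have incr (x y : R) : 0 < x -> x < y -> K x < K y.
  move=> x0 xy.
  have h1 z : z \in `]x, y[ -> derivable K z 1.
    by rewrite in_itv/= => /andP[/(lt_trans x0)/dK[]].
  have h2 z : z \in `]x, y[ -> 0 < derive1 K z.
    rewrite in_itv/= => /andP[/(lt_trans x0) z0 _]; rewrite derive1E.
    case: (dK _ z0) => _ ->; rewrite divr_gt0 ?exprn_gt0// mulr_gt0//.
    exact: normal_pdf01_gt0.
  have h3 : {within `[x, y], continuous K}.
    apply: derivable_within_continuous => z; rewrite in_itv/= => /andP[xz _].
    by case: (dK _ (lt_le_trans x0 xz)).
  exact: (gtr0_derive1_incr h1 h2 h3 (lexx x) xy (lexx y)).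
have le0 (x : R) : 0 < x -> K x <= 0.
  move=> x0; rewrite leNgt; apply/negP => Kx.
  (* Past this [M] the Gaussian tail is smaller than [K x], although [K] should have grown. *)
  have [M M0 EM] := @erf_sqrt2_gt R (1 - K x) ltac:(lra).
  pose y := x + M + 1.
  have y0 : 0 < y by rewrite /y; lra.
  have h1 : K x < K y by apply: incr => //; rewrite /y; lra.
  have h2 : erf_sqrt2 M < erf_sqrt2 y by apply: erf_sqrt2_mono; rewrite /y; lra.
  have h3 : 0 < 2 * p y * y^-1 by rewrite mulr_gt0 ?invr_gt0// mulr_gt0// normal_pdf01_gt0.
  rewrite /K in h1 Kx EM *; lra.
move=> s0; have : K s < 0.
  have /le0 : 0 < s + 1 by lra.
  by apply: lt_le_trans; apply: incr => //; lra.
by rewrite /K subr_lt0 -(ltr_pM2l s0) mulrCA divff ?mulr1// gt_eqF.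
Qed.

(** The difference vanishes at 0 and has derivative [x ^+ 2 * (2 * p x)]. *)
Lemma erf_sqrt2_sub_pdf_gt0 s : 0 < s -> 0 < erf_sqrt2 s - s * (2 * p s).
Proof.
pose D (x : R) := erf_sqrt2 x - x * (2 * p x).
have dD (x : R) : is_derive x 1 D (x ^+ 2 * (2 * p x)).
  have := is_derive1B (is_derive_erf_sqrt2 x)
    (is_derive1M (is_derive_id x 1) (is_derive1Ml 2 (is_derive_normal_pdf01 x))).
  by move/is_derive_eq; apply; ring.
move=> s0.
have h1 z : z \in `]0, s[ -> derivable D z 1 by move=> _; case: (dD z).
have h2 z : z \in `]0, s[ -> 0 < derive1 D z.
  rewrite in_itv/= => /andP[z0 _]; rewrite (derive1_funE dD).
  by rewrite mulr_gt0 ?exprn_gt0// mulr_gt0// normal_pdf01_gt0.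
have h3 : {within `[0, s], continuous D}.
  exact: continuous_subspaceT (is_derive1_continuous dD).
have := gtr0_derive1_incr h1 h2 h3 (lexx 0) s0 (lexx s).
by rewrite /D (@erf_sqrt2_0 R) mul0r subr0.
Qed.

Lemma derive_ginv_lt0 s : s != 0 -> derive1 ginv s < 0.
Proof.
move=> s0; rewrite derive1E; case: (is_derive_ginv s0) => _ ->.
have ps := @normal_pdf01_gt0 R s.
have Mills : s * (1 - erf_sqrt2 s) - 2 * p s < 0.
  have [|s_le0] := ltP 0 s; first by move/mills_ratio_lt; lra.
  have : s * (1 - erf_sqrt2 s) <= 0 by rewrite mulr_le0_ge0// subr_ge0 ltW// erf_sqrt2_lt1.
  lra.
(* Numerator and denominator are odd, so the quotient is even and negative [s] reduces to positive
   [s]. *)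
have pos : 0 < (erf_sqrt2 s - s * (2 * p s)) / erf_sqrt2 s ^+ 3.
  move: s0; rewrite neq_lt => /orP[s0|s0]; last first.
    by rewrite divr_gt0 ?erf_sqrt2_sub_pdf_gt0// exprn_gt0// erf_sqrt2_gt0.
  have sN : 0 < - s by rewrite oppr_gt0.
  have := erf_sqrt2_sub_pdf_gt0 sN; have := erf_sqrt2_gt0 sN; rewrite erf_sqrt2N normal_pdf01N => h1 h2.
  rewrite -[X in _ < X]opprK -mulNr -mulrN -invrN.
  have -> : - erf_sqrt2 s ^+ 3 = (- erf_sqrt2 s) ^+ 3 by ring.
  rewrite divr_gt0 ?exprn_gt0//; lra.
have -> : 2 * (erf_sqrt2 s - s * (2 * p s)) * (s * (1 - erf_sqrt2 s) - 2 * p s) / erf_sqrt2 s ^+ 3 =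
  2 * ((erf_sqrt2 s - s * (2 * p s)) / erf_sqrt2 s ^+ 3) * (s * (1 - erf_sqrt2 s) - 2 * p s) by ring.
by rewrite pmulr_rlt0// mulr_gt0.
Qed.

Lemma within_continuous_ginv (a b : R) : (0 < a \/ b < 0) ->
  {within `[a, b], continuous ginv}.
Proof.
move=> ab; apply: derivable_within_continuous => z; rewrite in_itv/= => /andP[az zb].
have z0 : z != 0 by case: ab => ?; [rewrite gt_eqF|rewrite lt_eqF]; lra.
by case: (is_derive_ginv z0).
Qed.

Lemma ginv_decr (x y : R) : (0 < x \/ y < 0) -> x < y -> ginv y < ginv x.
Proof.
move=> xy0 xy.
have z0 z : z \in `]x, y[ -> z != 0.
  by rewrite in_itv/= => /andP[? ?]; case: xy0 => ?; [rewrite gt_eqF|rewrite lt_eqF]; lra.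
have h1 z : z \in `]x, y[ -> derivable ginv z 1.
  by move=> /z0/is_derive_ginv[].
have h2 z : z \in `]x, y[ -> derive1 ginv z < 0 by move=> /z0; exact: derive_ginv_lt0.
exact: (ltr0_derive1_decr h1 h2 (within_continuous_ginv xy0) (lexx x) xy (lexx y)).
Qed.

(** By L'Hopital's rule on each side. The quotient of derivatives is s (1 - E) / (q E) - 1 with q =
    2 p, and E / s tends to q(0), so the limit is 1 / q(0)^2 - 1 with q(0)^2 = 2 / pi. *)
Lemma ginv_cvg0 : ginv x @[x --> 0^'] --> ((pi - 2) / 2 : R).
Proof.
pose df (x : R) := 2 * x * (1 - erf_sqrt2 x) - 2 * (2 * p x) * erf_sqrt2 x.
pose dg (x : R) := 2 * erf_sqrt2 x * (2 * p x).
have p0 := @normal_pdf01_gt0 R.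
have dg0 x : x != 0 -> dg x != 0.
  by move=> x0; rewrite /dg mulf_neq0// mulf_neq0 ?erf_sqrt2_neq0// gt_eqF.
have num0 : ginv_num x @[x --> (0 : R)] --> (0 : R).
  have h : ginv_num 0 = 0 by rewrite /ginv_num (@erf_sqrt2_0 R) expr0n/=; ring.
  by rewrite -[X in _ --> X]h; exact: (is_derive1_continuous is_derive_ginv_num).
have den0 : (erf_sqrt2 x) ^+ 2 @[x --> (0 : R)] --> (0 : R).
  have h : erf_sqrt2 0 ^+ 2 = 0 :> R by rewrite (@erf_sqrt2_0 R) expr0n.
  by rewrite -[X in _ --> X]h; exact: (is_derive1_continuous is_derive_sqr_erf_sqrt2).
have quot : df x / dg x @[x --> 0^'] --> ((pi - 2) / 2 : R).
  have slope : x^-1 * erf_sqrt2 x @[x --> (0 : R)^'] --> 2 * p 0.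
    have [+ dE] := is_derive_erf_sqrt2 (0 : R); rewrite /derivable => cv.
    have := cv; rewrite -[2 * p 0]dE /derive; set F := (X in X @ _).
    have -> : F = (fun x => x^-1 * erf_sqrt2 x).
      by apply/funext => x; rewrite /F /= (@erf_sqrt2_0 R) subr0 addr0 [_ *: 1]mulr1.
    by [].
  have -> : (pi - 2) / 2 = (1 - erf_sqrt2 0) / (2 * p 0) * (2 * p 0)^-1 - 1 :> R.
    have pi0 : pi != 0 :> R by rewrite gt_eqF// pi_gt0.
    rewrite (@erf_sqrt2_0 R) subr0 div1r -expr2 double_pdf expr0n/= mul0r expR0 divr1.
    rewrite exprVn sqr_sqrtr ?divr_ge0 ?pi_ge0//.
    by move: pi0; move: (pi : R) => x x0; field.
  apply: cvg_trans (_ : (fun x => (1 - erf_sqrt2 x) / (2 * p x) * (x^-1 * erf_sqrt2 x)^-1 - 1) @ 0^' --> _).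
    apply: near_eq_cvg; near=> x.
    have x0 : x != 0 by near: x; exact: nbhs_dnbhs_neq.
    have En0 := erf_sqrt2_neq0 x0; have pn0 : p x != 0 by rewrite gt_eqF.
    rewrite /df /dg; field.
    by rewrite x0 En0 pn0.
  apply: cvgB; last exact: cvg_cst.
  apply: cvgM.
    apply: cvg_within_filter; apply: cvgM.
      by apply: cvgB; [exact: cvg_cst | exact: continuous_erf_sqrt2].
    apply: cvgV; first by rewrite mulf_neq0// gt_eqF.
    by apply: cvgM; [exact: cvg_cst | exact: continuous_normal_pdf01].
  by apply: cvgV => //; rewrite mulf_neq0// gt_eqF.
apply: (@cvg_at_right_left_dnbhs _ R^o).
- have h1 (x : R) : x \in `]0, 1[ -> is_derive x 1 ginv_num (df x).
    by move=> _; exact: is_derive_ginv_num.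
  have h2 (x : R) : x \in `]0, 1[ -> is_derive x 1 (fun x => erf_sqrt2 x ^+ 2) (dg x).
    by move=> _; exact: is_derive_sqr_erf_sqrt2.
  have h3 (x : R) : x \in `]0, 1[ -> dg x != 0.
    by rewrite in_itv/= => /andP[x0 _]; rewrite dg0// gt_eqF.
  exact: (lhopital_at_right ltr01 h1 h2 (cvg_at_right_filter num0)
    (cvg_at_right_filter den0) h3 (cvg_dnbhs_at_right quot)).
- have h1 (x : R) : x \in `](-1), 0[ -> is_derive x 1 ginv_num (df x).
    by move=> _; exact: is_derive_ginv_num.
  have h2 (x : R) : x \in `](-1), 0[ -> is_derive x 1 (fun x => erf_sqrt2 x ^+ 2) (dg x).
    by move=> _; exact: is_derive_sqr_erf_sqrt2.
  have h3 (x : R) : x \in `](-1), 0[ -> dg x != 0.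
    by rewrite in_itv/= => /andP[_ x0]; rewrite dg0// lt_eqF.
  exact: (lhopital_at_left (ltrN10 R) h1 h2 (cvg_at_left_filter num0)
    (cvg_at_left_filter den0) h3 (cvg_dnbhs_at_left quot)).
Unshelve. all: by end_near. Qed.

Lemma ginv_gt0_lt s : 0 < s -> ginv s < (pi - 2) / 2.
Proof.
move=> s0; rewrite ltNge; apply/negP => hs.
(* The limit at 0 alone would give a weak inequality; passing through the intermediate point [s / 2]
   makes it strict. *)
have s20 : 0 < s / 2 by lra.
have : ginv s < ginv (s / 2) by apply: ginv_decr; [left|lra].
move=> /(le_lt_trans hs) h.
have [x [x0 xs hx]] : exists x, [/\ 0 < x, x < s / 2 & ginv x < ginv (s / 2)].
  near (0 : R)^'+ => x; exists x; split; near: x.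
  - exact: nbhs_right_gt.
  - exact: nbhs_right_lt.
  - exact: cvgr_lt (cvg_dnbhs_at_right ginv_cvg0) _ h.
have := ginv_decr (or_introl x0) xs; lra.
Unshelve. all: by end_near. Qed.

Lemma ginv_lt0_gt s : s < 0 -> (pi - 2) / 2 < ginv s.
Proof.
move=> s0; rewrite ltNge; apply/negP => hs.
have s20 : s / 2 < 0 by lra.
have : ginv (s / 2) < ginv s by apply: ginv_decr; [right|lra].
move=> /lt_le_trans-/(_ _ hs) h.
have [x [x0 xs hx]] : exists x, [/\ x < 0, s / 2 < x & ginv (s / 2) < ginv x].
  near (0 : R)^'- => x; exists x; split; near: x.
  - exact: nbhs_left_lt.
  - exact: nbhs_left_gt.
  - exact: cvgr_gt (cvg_dnbhs_at_left ginv_cvg0) _ h.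
have := ginv_decr (or_intror x0) xs; lra.
Unshelve. all: by end_near. Qed.

Lemma ginv_surj_pos c : 0 < c -> c < (pi - 2) / 2 -> exists2 s, 0 < s & ginv s = c.
Proof.
move=> c0 ck.
have [a [a0 a1 ha]] : exists x, [/\ 0 < x, x < 1 & c < ginv x].
  near (0 : R)^'+ => x; exists x; split; near: x.
  - exact: nbhs_right_gt.
  - exact: nbhs_right_lt.
  - exact: cvgr_gt (cvg_dnbhs_at_right ginv_cvg0) _ ck.
(* By the Mills bound [ginv b] is below (1 - E) / E, which is less than c once E > 1/2 and 1 - E < c
   / 2. *)
have [M M0 EM] : exists2 M : R, 0 <= M & Num.max 2^-1 (1 - c / 2) < erf_sqrt2 M.
  by apply: erf_sqrt2_gt; rewrite gt_max; apply/andP; split; lra.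
pose b := M + 1.
have b1 : 1 <= b by rewrite /b; lra.
have b0 : 0 < b by lra.
have [E1 E2] : 2^-1 < erf_sqrt2 b /\ 1 - c / 2 < erf_sqrt2 b.
  have : erf_sqrt2 M < erf_sqrt2 b by apply: erf_sqrt2_mono; rewrite /b; lra.
  by move: EM; rewrite gt_max => /andP[h1 h2] h3; split; lra.
have Eb1 := @erf_sqrt2_lt1 R b.
have hb : ginv b < c.
  rewrite /ginv ltr_pdivrMr ?exprn_gt0 ?erf_sqrt2_gt0//.
  have : ginv_num b < erf_sqrt2 b * (1 - erf_sqrt2 b).
    have -> : ginv_num b = erf_sqrt2 b * (1 - erf_sqrt2 b) + b * (b * (1 - erf_sqrt2 b) - 2 * p b).
      by rewrite /ginv_num; ring.
    by rewrite gtrDl pmulr_rlt0// subr_lt0 mills_ratio_lt.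
  move=> /lt_le_trans; apply; rewrite expr2 mulrCA ler_pM2l ?erf_sqrt2_gt0//; nra.
have [//|||s] := @IVT R ginv a b c.
- lra.
- by apply: within_continuous_ginv; left.
- by rewrite ge_min le_max (ltW hb) (ltW ha) orbT.
by rewrite in_itv/= => /andP[sa _] <-; exists s => //; lra.
Unshelve. all: by end_near. Qed.

Lemma ginv_surj_neg c : (pi - 2) / 2 < c -> exists2 s, s < 0 & ginv s = c.
Proof.
move=> kc.
have c0 : 0 < c by have := @pi_ge2 R; lra.
have [b [b0 b1 hb]] : exists x, [/\ x < 0, - 1 < x & ginv x < c].
  near (0 : R)^'- => x; exists x; split; near: x.
  - exact: nbhs_left_lt.
  - by apply: nbhs_left_gt; rewrite ltrN10.
  - exact: cvgr_lt (cvg_dnbhs_at_left ginv_cvg0) _ kc.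
(* With t = c + 2 the numerator at -t is at least t^2 - E, hence above c + 1, while the denominator
   is at most 1. Also -t < -1 < b. *)
pose t := c + 2; have t0 : 0 < t by rewrite /t; lra.
have Et0 := erf_sqrt2_gt0 t0; have Et1 := @erf_sqrt2_lt1 R t.
have ht : c < ginv (- t).
  rewrite /ginv ltr_pdivlMr ?erf_sqrt2N ?sqrrN ?exprn_gt0//.
  rewrite /ginv_num erf_sqrt2N normal_pdf01N sqrrN.
  have pt : 0 < t * (2 * p t) by rewrite mulr_gt0// mulr_gt0// normal_pdf01_gt0.
  have t2 : c + 1 <= t ^+ 2 - 1 by rewrite /t; nra.
  have h1 : c * erf_sqrt2 t ^+ 2 <= c by rewrite ler_piMr ?(ltW c0)// expr_le1 ?ltW.
  have h2 : t ^+ 2 - erf_sqrt2 t <= (1 - - erf_sqrt2 t) * (t ^+ 2 - erf_sqrt2 t).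
    by rewrite ler_peMl; lra.
  rewrite mulNr opprK; lra.
have [//|||s] := @IVT R ginv (- t) b c.
- rewrite /t; lra.
- by apply: within_continuous_ginv; right.
- by rewrite ge_min le_max (ltW hb) (ltW ht) orbT.
by rewrite in_itv/= => /andP[_ sb] <-; exists s => //; lra.
Unshelve. all: by end_near. Qed.

(** In terms of [ginv] the equation has right side [c^-1], and its position relative to the limit at
    0 decides on which half-line a solution can lie. Equality with that limit is excluded because
    the limit is not attained. *)
Lemma g_unique_solution c : 0 < c -> c != 2 / (pi - 2) ->
  exists s, [/\ s != 0, c = g s, (forall t, c = g t -> t = s) &
    (0 < s <-> 2 / (pi - 2) < c)].
Proof.
move=> c0 ck.
have k0 : 0 < pi - 2 :> R.
  by rewrite subr_gt0 pi_gt2.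
(* The numerator of [g] vanishes at 0, so [g 0] is 0 and differs from the positive [c]. *)
have gt0 t : c = g t -> t != 0.
  apply: contra_eq_neq => ->; rewrite /g mul0r (_ : erf 0 = 0); last first.
    by have := @erf_sqrt2_0 R; rewrite /erf_sqrt2 mul0r.
  by rewrite expr0n/= mulr0 mul0r gt_eqF.
have gE t : c = g t <-> ginv t = c^-1.
  by rewrite g_ginv; split => [->|->]; rewrite invrK.
have ltE : (2 / (pi - 2) < c) = (c^-1 < (pi - 2) / 2).
  by rewrite -[(pi - 2) / 2]invf_div ltf_pV2// posrE divr_gt0.
have ci0 : 0 < c^-1 by rewrite invr_gt0.
have neg t : t < 0 -> c = g t -> ~~ (c^-1 < (pi - 2) / 2).
  by move=> /ginv_lt0_gt + /gE => + h; rewrite h -leNgt => /ltW.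
have pos t : 0 < t -> c = g t -> c^-1 < (pi - 2) / 2.
  by move=> /ginv_gt0_lt + /gE => + h; rewrite h.
have inj s t : 0 < s -> 0 < t -> ginv s = ginv t -> s = t.
  move=> s0 t0 st; have [ltst|ltst|//] := ltgtP s t.
    by have := ginv_decr (or_introl s0) ltst; rewrite st ltxx.
  by have := ginv_decr (or_introl t0) ltst; rewrite st ltxx.
have injN s t : s < 0 -> t < 0 -> ginv s = ginv t -> s = t.
  move=> s0 t0 st; have [ltst|ltst|//] := ltgtP s t.
    by have := ginv_decr (or_intror t0) ltst; rewrite st ltxx.
  by have := ginv_decr (or_intror s0) ltst; rewrite st ltxx.
have [hc|hc] := boolP (c^-1 < (pi - 2) / 2).
- have [s s0 hs] := ginv_surj_pos ci0 hc.
  exists s; split; first by rewrite gt_eqF.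
  + exact/gE.
  + move=> t ht; have := gt0 _ ht; rewrite neq_lt => /orP[t0|t0].
      by have := neg _ t0 ht; rewrite hc.
    by apply: inj => //; rewrite hs; exact/gE.
  + by rewrite ltE.
- have hc' : (pi - 2) / 2 < c^-1.
    rewrite lt_neqAle leNgt hc andbT; apply: contra ck => /eqP h.
    by rewrite -[c]invrK -h invf_div.
  have [s s0 hs] := ginv_surj_neg hc'.
  exists s; split; first by rewrite lt_eqF.
  + exact/gE.
  + move=> t ht; have := gt0 _ ht; rewrite neq_lt => /orP[t0|t0]; last first.
      by have := pos _ t0 ht; rewrite (negbTE hc).
    by apply: injN => //; rewrite hs; exact/gE.
  + by rewrite ltE (negbTE hc); split => //; rewrite lt_gtF.
Qed.

End reciprocal_of_g.

(** * The lower bound on the norm and the functions attaining it *)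

Section minimizers.
Context {R : realType} {d : measure_display} {T : measurableType d}
  {P : probability T R} {Z : {RV P >-> R}} (hZ : law_std_normal Z).
Local Notation mu := (@lebesgue_measure R).
Local Notation p := (@normal_pdf R 0 1).
Implicit Types (sigma dsigma tau dtau : R -> R).

Lemma integrable_norm_pdf (f : R -> R) : measurable_fun setT f ->
  mu.-integrable setT (fun x => (`|f x| * p x)%:E) <->
  mu.-integrable setT (fun x => (f x * p x)%:E).
Proof.
move=> mf; have mp := @measurable_normal_pdf01 R.
split=> h.
  apply: (@le_integrable_EFin _ (fun x => f x * p x) _ _ _ h).
    exact: measurable_funM.
  by move=> x; rewrite normrM (ger0_norm (normal_pdf_ge0 0 1 x)).
apply: (@le_integrable_EFin _ (fun x => `|f x| * p x) _ _ _ (integrable_norm h)).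
  by apply: measurable_funM => //; exact: measurableT_comp.
by move=> x; rewrite /= !normrM normr_id.
Qed.

Lemma feasible_lower_bound (mu0 mu1 mu2 : R) tau dtau :
  feasible Z mu0 mu1 mu2 tau dtau ->
  (`|mu1|%:E <= 'E_P[fun w => `|dtau (Z w)|%R])%E.
Proof.
move=> [wd i2 id [_ e1 _]].
have [mtau mdtau] := weak_derivative_measurable wd.
have mtau2 : measurable_fun setT (fun x => tau x ^+ 2) by exact: measurable_funX.
have mndtau : measurable_fun setT (fun x => `|dtau x|) by exact: measurableT_comp.
have mxtau : measurable_fun setT (fun x : R => x * tau x) by exact: measurable_funM.
move/(integrable_std_normal hZ mtau2): i2 => i2.
move/(integrable_std_normal hZ mndtau): id => id.
have id' := (integrable_norm_pdf mdtau).1 id.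
have [_ i1] := integrable_moment1 mtau i2.
move: e1; rewrite (expectation_std_normal hZ mxtau i1) => -[<-].
rewrite (expectation_std_normal hZ mndtau id) lee_fin (stein wd i2 id').
apply: le_trans (le_normr_Rintegral measurableT id') _.
rewrite le_eqVlt; apply/orP; left; apply/eqP/eq_Rintegral => x _.
by rewrite normrM (ger0_norm (normal_pdf_ge0 0 1 x)).
Qed.

(** The constraint on the correlation with [Z] is supplied as the mean of [dsigma], through Stein's
    identity. The last hypothesis is how constancy of the sign of [dsigma] enters. *)
Lemma monotone_minimizer (mu0 mu1 mu2 : R) sigma dsigma :
  weak_derivative sigma dsigma ->
  mu.-integrable setT (fun x => (sigma x ^+ 2 * p x)%:E) ->
  mu.-integrable setT (fun x => (dsigma x * p x)%:E) ->
  \int[mu]_x (sigma x * p x) = mu0 ->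
  \int[mu]_x (dsigma x * p x) = mu1 ->
  \int[mu]_x (sigma x ^+ 2 * p x) = mu2 ->
  \int[mu]_x (`|dsigma x| * p x) = `|mu1| ->
  is_minimizer Z mu0 mu1 mu2 sigma.
Proof.
move=> wd i2 id e0 e1 e2 en.
have [ms mds] := weak_derivative_measurable wd.
have ms2 : measurable_fun setT (fun x => sigma x ^+ 2) by exact: measurable_funX.
have mnds : measurable_fun setT (fun x => `|dsigma x|) by exact: measurableT_comp.
have mxs : measurable_fun setT (fun x : R => x * sigma x) by exact: measurable_funM.
have [i0 i1] := integrable_moment1 ms i2.
have idn := (integrable_norm_pdf mds).2 id.
exists dsigma.
  split; [exact: wd | exact/(integrable_std_normal hZ ms2) |
    exact/(integrable_std_normal hZ mnds) | split].
  - by rewrite (expectation_std_normal hZ ms i0) e0.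
  - by rewrite (expectation_std_normal hZ mxs i1) (stein wd i2 id) e1.
  - by rewrite (expectation_std_normal hZ ms2 i2) e2.
move=> tau dtau /feasible_lower_bound.
by rewrite (expectation_std_normal hZ mnds idn) en.
Qed.

(** Common to finite and infinite thresholds: [f] is the clipping or the identity, both centered. *)
Lemma affine_moments (f : R -> R) (c b v : R) : measurable_fun setT f ->
  mu.-integrable setT (fun x => (f x ^+ 2 * p x)%:E) ->
  \int[mu]_x (f x * p x) = 0 -> \int[mu]_x (f x ^+ 2 * p x) = v ->
  [/\ mu.-integrable setT (fun x => ((c + b * f x) ^+ 2 * p x)%:E),
      \int[mu]_x ((c + b * f x) * p x) = c &
      \int[mu]_x ((c + b * f x) ^+ 2 * p x) = c ^+ 2 + b ^+ 2 * v].
Proof.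
move=> mf if2 f0 fv.
have [if1 _] := integrable_moment1 mf if2.
have ip := integrable_normal_pdf (0 : R) 1.
have sc (k : R) (h : R -> R) : mu.-integrable setT (fun x => (h x)%:E) ->
    mu.-integrable setT (fun x => (k * h x)%:E).
  by move=> ih; exact: (integrableZl measurableT k ih).
have e1 : (fun x => (c + b * f x) * p x) =
    (fun x => c * p x + b * (f x * p x)) by apply/funext => x; ring.
have e2 : (fun x => (c + b * f x) ^+ 2 * p x) =
    (fun x => (c ^+ 2 * p x + (2 * c * b) * (f x * p x)) + b ^+ 2 * (f x ^+ 2 * p x)).
  by apply/funext => x; ring.
have i3 := integrableD measurableT (sc (c ^+ 2) p ip) (sc (2 * c * b) _ if1).
have i4 := sc (b ^+ 2) _ if2.
split.
- have := integrableD measurableT i3 i4.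
  by congr (_.-integrable _ _); apply/funext => x /=; rewrite -!EFinD; congr EFin; ring.
- rewrite e1 RintegralD//; [|exact: sc|exact: sc].
  by rewrite !RintegralZl// f0 Rintegral_pdf; ring.
- rewrite e2 RintegralD// RintegralD//; [|exact: sc|exact: sc].
  by rewrite !RintegralZl// f0 fv Rintegral_pdf; ring.
Qed.

Lemma integral_itv_indic (b s : R) : 0 <= s ->
  mu.-integrable setT (fun x => (b * \1_(`[- s, s]) x * p x)%:E) /\
  \int[mu]_x (b * \1_(`[- s, s]) x * p x) = b * erf_sqrt2 s.
Proof.
move=> s0; have mI : measurable_fun setT (\1_(`[- s, s]) : R -> R).
  exact: measurable_indic.
have i1 : mu.-integrable setT (fun x => (\1_(`[- s, s]) x * p x)%:E).
  apply: (@bounded_pdf_integrable _ _ 1) => // x.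
  by rewrite indicE; case: (_ \in _); rewrite ?normr1 ?normr0.
have e : (fun x => b * \1_(`[- s, s]) x * p x) =
    (fun x => b * (\1_(`[- s, s]) x * p x)) by apply/funext => x; rewrite mulrA.
split.
  have := integrableZl measurableT b i1.
  by congr (_.-integrable _ _); apply/funext => x; rewrite -EFinM mulrA.
rewrite e RintegralZl// erf_sqrt2_integral//; congr (_ * _).
rewrite (@Rintegral_support _ _ `[- s, s]).
  by apply: eq_Rintegral => x xs; rewrite indicE xs mul1r.
by move=> x xs; rewrite indicE memNset// mul0r.
Qed.

Lemma clip_minimizer (mu0 mu1 mu2 s : R) : 0 < s ->
  mu2 = mu0 ^+ 2 + (mu1 / erf_sqrt2 s) ^+ 2 * (erf_sqrt2 s - s * (2 * p s) + s ^+ 2 * (1 - erf_sqrt2 s)) ->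
  is_minimizer Z mu0 mu1 mu2 (fun x => mu0 + mu1 / erf_sqrt2 s * clip s x).
Proof.
move=> s_gt0 mu2E; have s0 := ltW s_gt0.
set b := mu1 / erf_sqrt2 s.
have Es0 : erf_sqrt2 s != 0 by rewrite erf_sqrt2_neq0// gt_eqF.
have if2 : mu.-integrable setT (fun x => (clip s x ^+ 2 * p x)%:E).
  apply: (@bounded_pdf_integrable _ _ (s ^+ 2)).
    by apply: measurable_funX; exact: measurable_clip.
  by move=> x; rewrite normrX lerXn2r ?nnegrE// clip_bounded.
have [j2 e0 e2] := affine_moments mu0 b (@measurable_clip R s) if2
  (integral_clip s0) (integral_sqr_clip s0).
have [id e1] := integral_itv_indic b s0.
apply: (monotone_minimizer (weak_derivative_clip mu0 b s0) j2 id e0).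
- by rewrite e1 /b divfK.
- by rewrite e2 mu2E.
(* The derivative has the constant sign of [b], so its norm is the same integral with the modulus of
   [b] as coefficient. *)
- have -> : (fun x => `|b * \1_(`[- s, s]) x| * p x) =
      (fun x => `|b| * \1_(`[- s, s]) x * p x).
    by apply/funext => x; rewrite normrM [`|\1_ _ _|]ger0_norm// indicE.
  have [_ ->] := integral_itv_indic `|b| s0.
  by rewrite normrM normfV [`|erf_sqrt2 s|]gtr0_norm ?erf_sqrt2_gt0// divfK.
Qed.

Lemma affine_minimizer (mu0 mu1 : R) :
  is_minimizer Z mu0 mu1 (mu0 ^+ 2 + mu1 ^+ 2) (fun x => mu0 + mu1 * x).
Proof.
have mid : measurable_fun setT (id : R -> R) by exact: measurable_id.
have i2 := @integrable_sqr_normal_pdf01 R.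
have [i1 _] := integrable_moment1 mid i2.
have ip k : mu.-integrable setT (fun x => (cst k x * p x)%:E).
  exact: (integrableZl measurableT k (integrable_normal_pdf (0 : R) 1)).
have ep k : \int[mu]_x (cst k x * p x) = k.
  by rewrite RintegralZl ?Rintegral_pdf ?mulr1//; exact: integrable_normal_pdf.
have v1 : \int[mu]_x (x ^+ 2 * p x) = 1.
  (* Stein's identity for the identity function yields the second moment 1. *)
  have wd := @weak_derivative_affine R 0 1.
  rewrite (_ : (fun x : R => 0 + 1 * x) = id) in wd; last first.
    by apply/funext => x; rewrite add0r mul1r.
  have := stein wd i2 (ip 1).
  by rewrite ep => h; rewrite -[RHS]h; apply: eq_Rintegral => x _; rewrite expr2.
have z : \int[mu]_x (x * p x) = 0.
  apply: Rintegral_odd => //.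
    by apply: measurable_funM => //; exact: measurable_normal_pdf01.
  by move=> x; rewrite normal_pdf01N mulNr.
have [j2 e0 e2] := affine_moments mu0 mu1 mid i2 z v1.
apply: (monotone_minimizer (weak_derivative_affine mu0 mu1) j2 (ip mu1) e0 (ep mu1)).
- by rewrite e2 mulr1.
- exact: (ep `|mu1|).
Qed.

End minimizers.

(** * The activation at finite and infinite thresholds *)

Lemma clip_activationE {R : realType} (mu0 mu1 s : R) :
  clip_activation mu0 mu1 s%:E = (fun x => mu0 + mu1 / erf_sqrt2 s * clip s x).
Proof.
apply/funext => x; rewrite /clip_activation -EFinM /= /erf_sqrt2 /clip.
by rewrite -EFin_max -EFin_min.
Qed.

Lemma clip_activation_pinfty {R : realType} (mu0 mu1 : R) :
  clip_activation mu0 mu1 +oo%E = (fun x => mu0 + mu1 * x).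
Proof.
apply/funext => x; rewrite /clip_activation gt0_mulye ?lte_fin ?invr_gt0 ?sqrtr_gt0//.
by rewrite /= divr1 maxeNy miney.
Qed.

(** Three degeneracies of the equation shape the second half. For [mu1 = 0] the ratio is 0, met at
    [s = 0], where [g] is 0/0. The ratio [2 / (pi - 2)] is only approached at 0. Below it the
    solution is negative, and clipping then gives a constant, uncorrelated with [Z]; minimality is
    therefore claimed for [0 < s]. *)
Theorem theorem8 (R : realType) (d : measure_display) (T : measurableType d)
    (P : probability T R) (Z : {RV P >-> R}) (hZ : law_std_normal Z)
    (mu0 mu1 mu2 : R) (hmu : 0 <= mustar2 mu0 mu1 mu2) :
  (mustar2 mu0 mu1 mu2 = 0 ->
     is_minimizer Z mu0 mu1 mu2 (clip_activation mu0 mu1 +oo%E)) /\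
  (mustar2 mu0 mu1 mu2 != 0 ->
   mu1 != 0 ->
   mu1 ^+ 2 / mustar2 mu0 mu1 mu2 != 2 / (pi - 2) ->
     exists s : R,
       [/\ mu1 ^+ 2 / mustar2 mu0 mu1 mu2 = g s,
           (forall t : R, mu1 ^+ 2 / mustar2 mu0 mu1 mu2 = g t -> t = s),
           (0 < s <-> 2 / (pi - 2) < mu1 ^+ 2 / mustar2 mu0 mu1 mu2) &
           (0 < s ->
             is_minimizer Z mu0 mu1 mu2 (clip_activation mu0 mu1 s%:E))]).
Proof.
have mu2E : mu2 = mu0 ^+ 2 + mu1 ^+ 2 + mustar2 mu0 mu1 mu2 by rewrite /mustar2; ring.
split=> [mustar0|mustar0 mu10 critical].
  rewrite clip_activation_pinfty mu2E mustar0 addr0.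
  exact: affine_minimizer.
have mustar_gt0 : 0 < mustar2 mu0 mu1 mu2 by rewrite lt_neqAle eq_sym mustar0.
have ratio_gt0 : 0 < mu1 ^+ 2 / mustar2 mu0 mu1 mu2.
  by rewrite divr_gt0// exprn_even_gt0.
have [s [s0 gs uniq_s sign_s]] := g_unique_solution ratio_gt0 critical.
exists s; split => // s_gt0; rewrite clip_activationE.
apply: clip_minimizer => //; rewrite {1}mu2E -addrA; congr (_ + _).
have Es0 := erf_sqrt2_neq0 s0.
have := gs; rewrite g_ginv => /(congr1 (@GRing.inv R)).
rewrite invrK invf_div /ginv => /(congr1 (fun y => y * erf_sqrt2 s ^+ 2)).
rewrite [RHS]divfK ?expf_neq0// /ginv_num => h.
(* The second moment of the clipping is [ginv_num s + erf_sqrt2 s ^+ 2]; the equation for [g] fixes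
   the first summand, and the second contributes [mu1 ^+ 2]. *)
have -> : erf_sqrt2 s - s * (2 * normal_pdf 0 1 s) + s ^+ 2 * (1 - erf_sqrt2 s) =
    ((1 - erf_sqrt2 s) * (s ^+ 2 + erf_sqrt2 s) - s * (2 * normal_pdf 0 1 s)) + erf_sqrt2 s ^+ 2 by ring.
by rewrite -h; field; rewrite mu10.
Qed.
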